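(* Let $G$ be a finitely generated group, $Q$ a finitely generated nilpotent group and $\Phi\colon G\to Q$ a surjective group homomorphism. Put $\bar Z := \Phi^{-1}(Z(Q))$, where $Z(Q)$ is the center of $Q$. Then the following are equivalent: (1) $\ker\Phi$ is finitely generated; (2) $S_{\mathrm{ord}}(G,\ker\Phi)\subseteq\Sigma^1_{\mathrm{ord}}(G)$; (3) $S_{\mathrm{ord}}(\bar Z,\ker\Phi)\subseteq\Sigma^1_{\mathrm{ord}}(\bar Z)$.
   Context: An order on a group $G$ means a bi-invariant strict partial order: a relation $\prec$ on $G$ such that for all $f,g,h\in G$: not $g\prec g$; $g\prec h$ implies not $h\prec g$; $f\prec g$ and $g\prec h$ imply $f\prec h$; and $f\prec g$ implies $hf\prec hg$ and $fh\prec gh$. Write $g\preccurlyeq h$ if $g\prec h$ or $g=h$; $\succ,\succcurlyeq$ are the opposite relations. An element $g$ is positive if $1\prec g$. The order is trivial if $g\prec h$ holds for no pair $g,h$. A subset $S\subseteq G$ is an antichain if $s\prec t$ holds for no $s,t\in S$. Induced orders: if $\Phi\colon G\to Q$ is a group homomorphism and $\prec_Q$ is an order on $Q$, the order on $G$ induced by $\Phi$ (and $\prec_Q$) is given by $g\prec h \iff \Phi(g)\prec_Q\Phi(h)$. Properties of an order $\prec$ on $G$: It is archimedean if there are no $g,h\in G$ with $g$ positive and $g^i\prec h$ for all $i\in\mathbb{Z}$. It is primitive if for all $g,h\in G$ and $n\in\mathbb{N}$, $g^n\prec h^n$ implies $g\prec h$. It is factorizing if for every normal subgroup $H\trianglelefteq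 G$ that is an antichain, $\prec$ is induced by the projection $G\to G/H$ for some order on $G/H$. It is full if it is primitive and factorizing. Coarse connectedness: a subset $K\subseteq G$ of a group is coarsely connected if there exist a finitely generated subgroup $H\leqslant G$ containing $K$ and a finite generating set $S$ of $H$ such that the full subgraph of the Cayley graph $\mathrm{Cay}(H,S)$ spanned by $K$ (vertices the elements of $K$, edges all edges with both endpoints in $K$) is connected. For any group $G$ (not necessarily finitely generated), $\Sigma^1_{\mathrm{ord}}(G)$ consists of those non-trivial full archimedean orders $\prec$ on $G$ such that for every antichain normal subgroup $K\trianglelefteq G$ that is maximal among antichain normal subgroups, the set $K_{\succcurlyeq}=\{g\in G\mid \exists k\in K\colon g\succcurlyeq k\}$ is coarsely connected. For a normal subgroup $N\trianglelefteq G$, $S_{\mathrm{ord}}(G,N)$ consists of all orders on $G$ induced by the projection $\pi\colon G\to G/N$ from non-trivial full archimedean orders on $G/N$. *)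

(* Defs.v *)
From Stdlib Require Import Relations.
From HB Require Import structures.
From mathcomp Require Import all_boot ssrint.
From mathcomp Require Import boolp classical_sets cardinality.

Set Implicit Arguments.
Unset Strict Implicit.
Unset Printing Implicit Defensive.

Local Open Scope quotient_scope.
Local Open Scope classical_set_scope.
Local Open Scope group_scope.

Record subgroup (G : groupType) := Subgroup {
  subgroup_set :> set G;
  subgroup_closed : group_closed [in subgroup_set] }.

Record normalSubgroup (G : groupType) := NormalSubgroup {
  normal_subgroup :> subgroup G;
  normal_conjg : forall x g : G,
    subgroup_set normal_subgroup x -> subgroup_set normal_subgroup (x ^ g) }.

Section SubgroupTheory.
Variable G : groupType.
Implicit Types (H : subgroup G) (x y : G).

Lemma subgroup1 H : subgroup_set H 1.
Proof. by have [/set_mem] := subgroup_closed H. Qed.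

Lemma subgroupV H x : subgroup_set H x -> subgroup_set H x^-1.
Proof.
by move=> /mem_set Hx; apply/set_mem/(group_closedV (subgroup_closed H)).
Qed.

Lemma subgroupM H x y :
  subgroup_set H x -> subgroup_set H y -> subgroup_set H (x * y).
Proof.
move=> /mem_set Hx /mem_set Hy; apply/set_mem.
exact: (group_closedM (subgroup_closed H)).
Qed.

Lemma is_group_closed (A : set G) :
    A 1 -> (forall x y, A x -> A y -> A (x * y)) ->
    (forall x, A x -> A x^-1) -> group_closed [in A].
Proof.
move=> A1 AM AV; split; first exact: mem_set.
by move=> x y /set_mem Ax /set_mem Ay; apply/mem_set/AM/AV.
Qed.

End SubgroupTheory.

Definition generated (G : groupType) (S : set G) : set G :=
  smallest (fun H : set G => group_closed [in H]) S.

Definition finitely_generated (G : groupType) (H : set G) : Prop :=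
  exists S : set G, finite_set S /\ generated S = H.

Fixpoint lower_central (G : groupType) (n : nat) : set G :=
  if n is n'.+1 then
    generated [set z | exists x y : G, lower_central n' x /\ z = [~ x, y]]
  else [set: G].

Definition nilpotent_group (G : groupType) : Prop :=
  exists n, lower_central n = [set 1 : G].

Definition center (G : groupType) : set G :=
  [set z | forall x : G, commute z x].

Lemma center_closed (G : groupType) : group_closed [in center (G := G)].
Proof.
apply: is_group_closed => [x|x y Zx Zy z|x Zx z].
- exact/commute_sym/commute1.
- exact/commute_sym/commuteM/commute_sym/Zy/commute_sym/Zx.
- exact/commute_sym/commuteV/commute_sym/Zx.
Qed.

Definition center_subgroup (G : groupType) : subgroup G :=
  Subgroup (@center_closed G).

Section Morphism.
Variables (G Q : groupType) (Phi : UMagmaMorphism.type G Q).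

Lemma preimage_closed (H : subgroup Q) : group_closed [in Phi @^-1` (H : set Q)].
Proof.
apply: is_group_closed => [|x y Hx Hy|x Hx] /=.
- by rewrite gmulf1; exact: subgroup1.
- by rewrite gmulfM; exact: subgroupM.
- by rewrite gmulfV; exact: subgroupV.
Qed.

Definition preimage_subgroup (H : subgroup Q) : subgroup G :=
  Subgroup (preimage_closed H).

Lemma ker_closed : group_closed [in [set g | Phi g = 1]].
Proof.
apply: is_group_closed => [|x y /= x1 y1|x /= x1] /=.
- exact: gmulf1.
- by rewrite gmulfM x1 y1 mulg1.
- by rewrite gmulfV x1 invg1.
Qed.

Lemma ker_conjg (x g : G) :
  subgroup_set (Subgroup ker_closed) x -> subgroup_set (Subgroup ker_closed) (x ^ g).
Proof. by rewrite /= gmulfJ => ->; rewrite conj1g. Qed.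

Definition kernel : normalSubgroup G := NormalSubgroup ker_conjg.

End Morphism.

Definition subgroup_type (G : groupType) (H : subgroup G) : Type := set_type H.

Section SubgroupType.
Variables (G : groupType) (H : subgroup G).

HB.instance Definition _ := SubChoice.on (subgroup_type H).
HB.instance Definition _ :=
  SubChoice_isSubGroup.Build G [in subgroup_set H] (subgroup_type H)
    (subgroup_closed H).

Definition inclusion : subgroup_type H -> G := val.

Lemma inclusionM : {morph inclusion : x y / x * y}.
Proof. exact: valM. Qed.

Lemma inclusion1 : inclusion 1 = 1.
Proof. exact: val1. Qed.

HB.instance Definition _ :=
  isUMagmaMorphism.Build (subgroup_type H) G inclusion (inclusion1, inclusionM).

(** The normal subgroup [N] intersected with [H], as a subgroup of [H]. *)
Variable N : normalSubgroup G.

Lemma restrict_conjg (x g : subgroup_type H) :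
  subgroup_set (preimage_subgroup inclusion N) x ->
  subgroup_set (preimage_subgroup inclusion N) (x ^ g).
Proof. by rewrite /= gmulfJ; exact: normal_conjg. Qed.

Definition restrict_normal : normalSubgroup (subgroup_type H) :=
  NormalSubgroup restrict_conjg.

End SubgroupType.

Section QuotientGroup.
Variables (G : groupType) (N : normalSubgroup G).
Implicit Types x y : G.

Definition coset_rel : rel G := fun x y => x^-1 * y \in subgroup_set N.

Lemma coset_relP x y : reflect (subgroup_set N (x^-1 * y)) (coset_rel x y).
Proof. by apply: (iffP idP) => [/set_mem|/mem_set]. Qed.

Lemma coset_rel_refl : reflexive coset_rel.
Proof. by move=> x; apply/coset_relP; rewrite mulVg; exact: subgroup1. Qed.

Lemma coset_rel_sym : symmetric coset_rel.
Proof.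
by move=> x y; apply/coset_relP/coset_relP => /subgroupV; rewrite invgM invgK.
Qed.

Lemma coset_rel_trans : transitive coset_rel.
Proof.
move=> y x z /coset_relP xy /coset_relP yz; apply/coset_relP.
by have := subgroupM xy yz; rewrite mulgA mulgK.
Qed.

Canonical coset_equiv :=
  EquivRel coset_rel coset_rel_refl coset_rel_sym coset_rel_trans.

Definition quotient_group : Type := {eq_quot coset_equiv}.

HB.instance Definition _ := EqQuotient.on quotient_group.
HB.instance Definition _ := Choice.on quotient_group.

Definition proj (x : G) : quotient_group := \pi_quotient_group x.

Lemma projP x y : proj x = proj y <-> subgroup_set N (x^-1 * y).
Proof.
split=> [/eqP|Nxy]; first by rewrite /proj piE => /coset_relP.
by apply/eqP; rewrite /proj piE; apply/coset_relP.
Qed.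

Lemma reprK_proj (a : quotient_group) : proj (repr a) = a.
Proof. exact: reprK. Qed.

Definition quotient_mul (a b : quotient_group) := proj (repr a * repr b).
Definition quotient_inv (a : quotient_group) := proj (repr a)^-1.

Lemma proj_mul x y : quotient_mul (proj x) (proj y) = proj (x * y).
Proof.
apply/projP; have /projP Nx := reprK_proj (proj x).
have /projP Ny := reprK_proj (proj y).
set x' := repr _ in Nx *; set y' := repr _ in Ny *.
have := subgroupM (normal_conjg y' Nx) Ny; rewrite /conjg !mulgA.
by rewrite mulgK invgM.
Qed.

Lemma proj_inv x : quotient_inv (proj x) = proj x^-1.
Proof.
apply/projP; have /projP Nx := reprK_proj (proj x).
set x' := repr _ in Nx *.
have := normal_conjg x^-1 (subgroupV Nx).
by rewrite /conjg invgM !invgK !mulgA mulgV mul1g.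
Qed.

Lemma quotient_mulA : associative quotient_mul.
Proof.
move=> a b c; rewrite -(reprK_proj a) -(reprK_proj b) -(reprK_proj c).
by rewrite !proj_mul mulgA.
Qed.

Lemma quotient_mul1 : left_id (proj 1) quotient_mul.
Proof. by move=> a; rewrite -(reprK_proj a) proj_mul mul1g. Qed.

Lemma quotient_mulr1 : right_id (proj 1) quotient_mul.
Proof. by move=> a; rewrite -(reprK_proj a) proj_mul mulg1. Qed.

Lemma quotient_mulV : left_inverse (proj 1) quotient_inv quotient_mul.
Proof.
by move=> a; rewrite -(reprK_proj a) proj_inv proj_mul mulVg.
Qed.

Lemma quotient_mulrV : right_inverse (proj 1) quotient_inv quotient_mul.
Proof.
by move=> a; rewrite -(reprK_proj a) proj_inv proj_mul mulgV.
Qed.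

HB.instance Definition _ := isGroup.Build quotient_group
  quotient_mulA quotient_mul1 quotient_mulr1 quotient_mulV quotient_mulrV.

Lemma projM : {morph proj : x y / x * y}.
Proof. by move=> x y; rewrite -proj_mul. Qed.

Lemma proj1g : proj 1 = 1.
Proof. by []. Qed.

HB.instance Definition _ :=
  isUMagmaMorphism.Build G quotient_group proj (proj1g, projM).

End QuotientGroup.

Definition zpow (G : groupType) (g : G) (i : int) : G :=
  match i with Posz n => g ^+ n | Negz n => g ^- n.+1 end.

Section Orders.
Variable G : groupType.
Implicit Types (lt : relation G) (f g h : G) (A : set G).

Record is_order lt : Prop := IsOrder {
  order_irr : forall g, ~ lt g g;
  order_asym : forall g h, lt g h -> ~ lt h g;
  order_trans : forall f g h, lt f g -> lt g h -> lt f h;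
  order_mull : forall f g h, lt f g -> lt (h * f) (h * g);
  order_mulr : forall f g h, lt f g -> lt (f * h) (g * h) }.

Definition order_le lt g h : Prop := lt g h \/ g = h.

Definition positive lt g : Prop := lt 1 g.

Definition trivial_order lt : Prop := forall g h, ~ lt g h.

Definition antichain lt A : Prop := forall s t, A s -> A t -> ~ lt s t.

Definition archimedean lt : Prop :=
  ~ exists g h, positive lt g /\ forall i : int, lt (zpow g i) h.

Definition primitive lt : Prop :=
  forall g h (n : nat), lt (g ^+ n) (h ^+ n) -> lt g h.

End Orders.

Definition induced_order (G Q : groupType) (Phi : UMagmaMorphism.type G Q)
    (ltQ : relation Q) : relation G :=
  fun g h => ltQ (Phi g) (Phi h).

Definition factorizing (G : groupType) (lt : relation G) : Prop :=
  forall H : normalSubgroup G, antichain lt H ->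
    exists2 ltQ : relation (quotient_group H),
      is_order ltQ & lt = induced_order (proj H) ltQ.

Definition full (G : groupType) (lt : relation G) : Prop :=
  primitive lt /\ factorizing lt.

Definition nontrivial_full_archimedean (G : groupType) : set (relation G) :=
  [set lt | [/\ is_order lt, ~ trivial_order lt, full lt & archimedean lt]].

(** Undirected Cayley graph, with generators acting on the right. *)
Definition cayley_adj (G : groupType) (H S : set G) : relation G :=
  fun g h => [/\ H g, H h & exists2 s, S s & h = g * s \/ g = h * s].

Definition spanned_adj (T : Type) (adj : relation T) (K : set T) : relation T :=
  fun x y => [/\ K x, K y & adj x y].

Definition spans_connected (T : Type) (adj : relation T) (K : set T) : Prop :=
  forall x y, K x -> K y -> clos_refl_trans T (spanned_adj adj K) x y.

Definition coarsely_connected (G : groupType) (K : set G) : Prop :=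
  exists (H : subgroup G) (S : set G),
    [/\ finite_set S, generated S = H, K `<=` H
      & spans_connected (cayley_adj H S) K].

Definition maximal_antichain_normal (G : groupType) (lt : relation G)
    (K : normalSubgroup G) : Prop :=
  antichain lt K /\
  forall K' : normalSubgroup G, antichain lt K' -> K `<=` K' -> K' `<=` K.

Definition upper_set (G : groupType) (lt : relation G) (K : set G) : set G :=
  [set g | exists2 k, K k & order_le lt k g].

Definition Sigma1_ord (G : groupType) : set (relation G) :=
  [set lt | nontrivial_full_archimedean lt /\
     forall K : normalSubgroup G,
       maximal_antichain_normal lt K -> coarsely_connected (upper_set lt K)].

Definition S_ord (G : groupType) (N : normalSubgroup G) : set (relation G) :=
  [set lt | exists2 ltQ : relation (quotient_group N),
     nontrivial_full_archimedean ltQ & lt = induced_order (proj N) ltQ].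

(* Main.v *)
From Stdlib Require Import Relations.
Require Import Defs.
From HB Require Import structures.
From mathcomp Require Import all_boot order ssralg ssrnum ssrint zmodp matrix.
From mathcomp Require Import boolp classical_sets cardinality filter.
From mathcomp Require Import zify.

Set Implicit Arguments.
Unset Strict Implicit.
Unset Printing Implicit Defensive.

(** Write [N] for the kernel of [Phi]. The elements [u] such that [g * u] is
    positive exactly when [g] is form a normal subgroup, the isotropy of the
    order. For a factorizing order it is the largest antichain normal subgroup,
    so the coarse connectivity demanded by [Sigma1_ord] concerns a single set:
    the half-space of all elements that are positive or in the isotropy.

    The shape of full archimedean orders on a nilpotent quotient is what makes
    the theorem work. Modulo the isotropy every central element is comparable
    with 1 ([central_comparable]), and every positive element is central
    ([positive_central_mod]); so such an order is a total order on the centre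
    of the quotient by the isotropy.

    If [N] is finitely generated, then so is every subgroup containing [N],
    because finitely generated nilpotent groups are noetherian
    ([noetherian_nilpotent]). An element of the half-space is then reached from
    1 by multiplying by positive generators first and by their inverses
    afterwards, without leaving the half-space
    ([half_space_coarsely_connected]).

    The converse for an abelian quotient ([finitely_generated_of_orders]) is
    the argument of Bieri, Neumann and Strebel. One may assume that [N] is the
    kernel of a homomorphism to [Z^n]. A path in the Cayley graph between two
    elements of [N] is pulled towards [N] by rerouting it around its vertices of
    largest norm. If the rerouting failed at vertices of arbitrarily large norm,
    an ultrafilter on these vertices would single out a limit direction, hence a
    full archimedean order ([direction_order_nfa]), and the connectivity of its
    half-space provides the missing detour ([pushable_limit]). The ultrafilter
    plays the part of the compactness of the sphere of characters.

    For a nilpotent quotient, suppose that [N] is not finitely generated and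
    enlarge it to a maximal normal subgroup [M] with this property. Let [Z] be
    the preimage of the centre of [G / M]; it is strictly larger than [M], hence
    finitely generated, and the abelian case would make [M] finitely generated
    if all half-spaces of [Z] over [M] were coarsely connected. If the isotropy
    of an order on [Z] is larger than [M], it is finitely generated and the
    first implication applies. If it equals [M], the same positive cone defines
    a full archimedean order on [G] ([extended_order_nfa]) with the same
    half-space, which is coarsely connected by hypothesis.

    For the preimage [Zbar] of the centre of [Q], the existence of one order
    already forces [Zbar] to be finitely generated, and the abelian case applies
    to it. If there is no order at all, the centre of [Q] is torsion, hence so
    is [Q] ([torsion_kernel]); then there is no order on [G] to consider
    either, and the nilpotent case applies vacuously. *)

Import Order.TTheory GRing.Theory Num.Theory.

Local Open Scope classical_set_scope.
Local Open Scope group_scope.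

(** * Subgroups, central series and the noetherian property *)

Section Subgroups.
Variable G : groupType.
Implicit Types (A B S M : set G) (a g u x y : G).

Definition is_subgroup A : Prop :=
  [/\ A 1, forall x y, A x -> A y -> A (x * y) & forall x, A x -> A x^-1].

Definition is_normal A : Prop :=
  is_subgroup A /\ forall x g, A x -> A (x ^ g).

Lemma is_subgroupX A x n : is_subgroup A -> A x -> A (x ^+ n).
Proof.
case=> A1 AM _ Ax; elim: n => [|n IH]; first by rewrite expg0.
by rewrite expgS; apply: AM.
Qed.

Lemma subgroupP (H : subgroup G) : is_subgroup H.
Proof. by split; [exact: subgroup1|exact: subgroupM|exact: subgroupV]. Qed.

Lemma normalP (N : normalSubgroup G) : is_normal N.
Proof. by split; [exact: subgroupP|exact: normal_conjg]. Qed.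

Definition mk_subgroup A (hA : is_subgroup A) : subgroup G :=
  Subgroup (let: And3 A1 AM AV := hA in is_group_closed A1 AM AV).

Definition mk_normal A (hA : is_normal A) : normalSubgroup G :=
  @NormalSubgroup G (mk_subgroup hA.1) hA.2.

Lemma group_closed_subgroup A : group_closed [in A] -> is_subgroup A.
Proof.
move=> hA; split=> [|x y /mem_set Ax /mem_set Ay|x /mem_set Ax].
- by case: hA => /set_mem.
- exact/set_mem/(group_closedM hA).
- exact/set_mem/(group_closedV hA).
Qed.

Lemma generated_subgroup S : is_subgroup (generated S).
Proof.
split=> [A [] /group_closed_subgroup[]//|x y gx gy A hA|x gx A hA];
  have [/group_closed_subgroup[_ AM AV] _] := hA.
  by apply: AM; [apply: gx|apply: gy].
by apply: AV; apply: gx.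
Qed.

Lemma sub_generated S : S `<=` generated S.
Proof. exact: sub_gen_smallest. Qed.

Lemma generated_min S A : is_subgroup A -> S `<=` A -> generated S `<=` A.
Proof. by move=> [A1 AM AV] SA; apply: smallest_sub => //; exact: is_group_closed. Qed.

Lemma generatedS S S' : S `<=` S' -> generated S `<=` generated S'.
Proof.
move=> SS'; apply: generated_min; first exact: generated_subgroup.
by move=> x /SS'; exact: sub_generated.
Qed.

Lemma generated_normal S :
  (forall x g, S x -> generated S (x ^ g)) -> is_normal (generated S).
Proof.
move=> Sg; split; first exact: generated_subgroup.
move=> x g gx; move: x gx; apply: (@generated_min S [set x | generated S (x ^ g)]);
  last by move=> x Sx; exact: Sg.
have [g1 gM gV] := generated_subgroup S.
split=> [|x y gx gy|x gx] /=; first by rewrite conj1g.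
  by rewrite conjMg; apply: gM.
by rewrite conjVg; apply: gV.
Qed.

Definition span A (l : seq G) : set G := generated (A `|` [set` l]).

Lemma span_subgroup A l : is_subgroup (span A l).
Proof. exact: generated_subgroup. Qed.

Lemma sub_span A l : A `<=` span A l.
Proof. by move=> x Ax; apply: sub_generated; left. Qed.

Lemma mem_span A l x : x \in l -> span A l x.
Proof. by move=> xl; apply: sub_generated; right. Qed.

Lemma span_min A l B : is_subgroup B -> A `<=` B -> {in l, forall x, B x} ->
  span A l `<=` B.
Proof. by move=> hB AB lB; apply: generated_min => // x [/AB|/lB]. Qed.

Lemma fgP A : finitely_generated A <-> exists l : seq G, generated [set` l] = A.
Proof.
split=> [[S [/finite_seqP[l ->] <-]]|[l <-]]; first by exists l.
by exists [set` l]; split=> //; apply/finite_seqP; exists l.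
Qed.

Lemma projE1 (N : normalSubgroup G) x : proj N x = 1 <-> subgroup_set N x.
Proof.
rewrite -[1](proj1g N); split=> [/esym/projP|Mx].
  by rewrite invg1 mul1g.
by apply/esym/projP; rewrite invg1 mul1g.
Qed.

(** The preimage of the centre of the quotient by [A]. *)
Definition central_mod A : set G := [set u | forall x, A [~ u, x]].

Section Normal.
Variables (M : set G) (hM : is_normal M).

Definition pr := proj (mk_normal hM).

Lemma prP x y : pr x = pr y <-> M (x^-1 * y). Proof. exact: projP. Qed.

Lemma prE1 x : pr x = 1 <-> M x. Proof. exact: projE1. Qed.

Lemma prM x y : pr (x * y) = pr x * pr y. Proof. exact: projM. Qed.

Lemma prV x : pr x^-1 = (pr x)^-1. Proof. exact: gmulfV. Qed.

Lemma central_modP u : central_mod M u <-> forall x, commute (pr u) (pr x).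
Proof.
split=> cu x.
  by apply/commgP; rewrite /pr -gmulfR; apply/eqP/prE1/cu.
by apply/prE1; rewrite /pr gmulfR; apply/eqP/commgP/cu.
Qed.

Lemma central_mod_normal : is_normal (central_mod M).
Proof.
split; first split.
- by apply/central_modP => x; rewrite /pr gmulf1; exact/commute_sym/commute1.
- move=> x y /central_modP cx /central_modP cy; apply/central_modP => z.
  by rewrite /pr gmulfM; apply/commute_sym/commuteM; apply/commute_sym; [apply: cx|apply: cy].
- move=> x /central_modP cx; apply/central_modP => z.
  by rewrite /pr gmulfV; apply/commute_sym/commuteV/commute_sym/cx.
move=> x g /central_modP cx; apply/central_modP => z.
by rewrite /pr gmulfJ /conjg (cx g) mulgA mulVg mul1g; exact: cx.
Qed.

Lemma sub_central_mod : M `<=` central_mod M.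
Proof.
move=> x Mx g; have [[_ MM MV] MJ] := hM.
by apply: MM; [apply: MV|apply: MJ].
Qed.
End Normal.

(** The upper central series of the quotient by [A], pulled back. Working
    relative to [A] avoids iterated quotient types. *)
Fixpoint upper_central A n : set G :=
  if n is n'.+1 then central_mod (upper_central A n') else A.

Lemma upper_central_normal M n : is_normal M -> is_normal (upper_central M n).
Proof. by move=> hM; elim: n => [|n IH] //=; exact: central_mod_normal. Qed.

Definition nilpotent_mod A := exists n, upper_central A n = [set: G].

Lemma lower_central_subgroup n : is_subgroup (lower_central (G := G) n).
Proof. by case: n => [|n]; [split|exact: generated_subgroup]. Qed.

Lemma lower_central_normal n : is_normal (lower_central (G := G) n).
Proof.
elim: n => [|n IH]; first by [].
apply: generated_normal => _ g [x [y [Lx ->]]]; apply: sub_generated.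
by exists (x ^ g), (y ^ g); rewrite conjRg; split=> //; apply: IH.2.
Qed.

Lemma lower_central_comm n x y : lower_central n x -> lower_central n.+1 [~ x, y].
Proof. by move=> Lx; apply: sub_generated; exists x, y. Qed.

(** A term of the upper central series contains everything whose commutators lie
    in the term below, so the lower central series cannot overtake it. *)
Lemma lower_central_sub M n i : is_normal M ->
  upper_central M n = [set: G] -> i <= n ->
  lower_central i `<=` upper_central M (n - i).
Proof.
move=> hM Un; elim: i => [|i IH] ltin; first by rewrite subn0 Un.
apply: generated_min; first by case: (upper_central_normal (n - i.+1) hM).
move=> _ [x [y [Lx ->]]]; have := IH (ltnW ltin) _ Lx.
by rewrite -(subnSK ltin); apply.
Qed.

Lemma nilpotent_mod_lower M : is_normal M -> nilpotent_mod M ->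
  exists n, lower_central n `<=` M.
Proof.
move=> hM [n Un]; exists n => x /(lower_central_sub hM Un (leqnn n)).
by rewrite subnn.
Qed.

(** Repeatedly taking commutators moves [x] down the upper central series, so
    the last iterated commutator outside [A] is central modulo [A]. With [B]
    normal, this says that a nontrivial normal subgroup of a nilpotent group
    meets the centre. *)
Lemma central_mod_meet A B x : nilpotent_mod A ->
  (forall x y, B x -> B [~ x, y]) -> B x -> ~ A x ->
  exists u, [/\ B u, ~ A u & central_mod A u].
Proof.
move=> [n Un] BC Bx nAx; have : upper_central A n x by rewrite Un.
clear Un; elim: n x Bx nAx => [|n IH] x Bx nAx Ux; first by [].
have [cx|/existsNP[y nAxy]] := pselect (central_mod A x); first by exists x.
by apply: (IH [~ x, y]) => //; exact: BC.
Qed.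

(** The subgroup generated by [A] and [a], when [a] normalizes [A]. Two natural
    exponents replace one integer exponent. *)
Definition cyclic_ext A a : set G :=
  [set g | exists m i j, A m /\ g = m * a ^+ i * a ^- j].

Lemma cyclic_ext_subgroup A a : is_subgroup A ->
  (forall x, A x -> A (x ^ a) /\ A (x ^ a^-1)) -> is_subgroup (cyclic_ext A a).
Proof.
move=> [A1 AM AV] Aa.
have AJ n x : A x -> A (x ^ (a ^+ n)) /\ A (x ^ (a ^- n)).
  elim: n x => [|n IH] x Ax; first by rewrite expg0 invg1 conjg1.
  rewrite expgSr invgM !conjgM; split; first by apply: (Aa _ _).1; apply: (IH _ _).1.
  by apply: (IH _ _).2; apply: (Aa _ _).2.
have comm i j : a ^- i * a ^+ j = a ^+ j * a ^- i.
  by apply: commute_sym; apply: commuteV; rewrite /commute -!expgnDr addnC.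
split.
- by exists 1, 0, 0; rewrite expg0 invg1 !mulg1.
- move=> _ _ [m [i [j [Am ->]]]] [m' [i' [j' [Am' ->]]]].
  exists (m * m' ^ (a ^+ j * a ^- i)), (i + i'), (j' + j); split.
    by apply: AM => //; rewrite conjgM; apply: (AJ _ _ _).2; apply: (AJ _ _ _).1.
  rewrite !expgnDr /conjg !invgM !invgK -!mulgA; congr (_ * _).
  rewrite !mulgA !mulgVK -!mulgA; congr (_ * (_ * (_ * _))).
  by rewrite !mulgA -expgnDr addnC expgnDr !gnorm.
- move=> _ [m [i [j [Am ->]]]].
  exists (m^-1 ^ (a ^+ i * a ^- j)), j, i; split.
    by rewrite conjgM; apply: (AJ _ _ _).2; apply: (AJ _ _ _).1; apply: AV.
  by rewrite /conjg !gnorm.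
Qed.

Lemma sub_cyclic_ext A a : A `<=` cyclic_ext A a.
Proof. by move=> x Ax; exists x, 0, 0; rewrite expg0 invg1 !mulg1. Qed.

Lemma cyclic_ext_gen A a : A 1 -> cyclic_ext A a a.
Proof. by move=> A1; exists 1, 1%N, 0%N; rewrite expg0 expg1 invg1 mulg1 mul1g. Qed.

Lemma cyclic_ext_normal M a : is_normal M -> central_mod M a ->
  is_normal (cyclic_ext M a).
Proof.
move=> hM ca; have hC : is_subgroup (cyclic_ext M a).
  by apply: cyclic_ext_subgroup => [|x Mx]; [exact: hM.1|split; exact: hM.2].
split=> // _ g [m [i [j [Mm ->]]]]; have [C1 CM CV] := hC.
have Cag : cyclic_ext M a (a ^ g).
  rewrite -(mulVKg a (a ^ g)); apply: (CM) => //.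
    by apply: cyclic_ext_gen; case: hM => -[].
  exact/sub_cyclic_ext/ca.
rewrite !conjMg conjVg !conjXg.
apply: (CM _ _ (CM _ _ _ _)); last exact/CV/(is_subgroupX _ hC).
  exact/sub_cyclic_ext/hM.2.
exact: (is_subgroupX _ hC).
Qed.

Definition fg_mod N A := exists l : seq G, span N l = A.

Definition noetherian_mod N A :=
  forall H, is_subgroup H -> N `<=` H -> H `<=` A -> fg_mod N H.

Lemma fg_mod_fg N A : fg_mod N A -> finitely_generated N -> finitely_generated A.
Proof.
move=> [l lA] /fgP[k kN]; apply/fgP; exists (k ++ l); rewrite -lA.
apply/seteqP; split; (apply: generated_min; first exact: generated_subgroup).
  move=> x /=; rewrite mem_cat => /orP[xk|]; last exact: mem_span.
  by apply: sub_span; rewrite -kN; exact: sub_generated.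
move=> x [|xl]; last by apply: sub_generated => /=; rewrite mem_cat xl orbT.
rewrite -kN; apply: generatedS => {x} x /=; by rewrite mem_cat => ->.
Qed.

(** The exponents of [a] occurring in [H] form a cyclic subgroup of the
    integers, so [H] is generated by its intersection with [A] and by one
    element whose exponent [d] is least positive: division by [d] reduces every
    other element to exponent 0. *)
Lemma noetherian_cyclic_ext N A a : is_subgroup A -> N `<=` A ->
  (forall x, A x -> A (x ^ a) /\ A (x ^ a^-1)) ->
  noetherian_mod N A -> noetherian_mod N (cyclic_ext A a).
Proof.
move=> hA NA Aa noeA H hH NH HA; have [A1 AM AV] := hA; have [H1 HM HV] := hH.
have [l lE] : fg_mod N (H `&` A).
  apply: noeA; [|by move=> x Nx; split; [exact: NH|exact: NA]|by move=> x []].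
  by split=> [|x y [? ?] [? ?]|x [? ?]]; split; auto.
have AJ n x : A x -> A (x ^ (a ^- n)).
  elim: n x => [|n IH] x Ax; first by rewrite expg0 invg1 conjg1.
  by rewrite expgSr invgM conjgM; apply: IH; apply: (Aa _ _).2.
(* Up to inversion only natural exponents of [a] are needed. *)
have repH x : H x -> exists m j, A m /\ (x = m * a ^+ j \/ x^-1 = m * a ^+ j).
  move=> /HA[m [i [j [Am ->]]]]; have [ji|/ltnW ij] := leqP j i.
    by exists m, (i - j); split=> //; left; rewrite expgnFr // mulgA.
  exists (m^-1 ^ (a ^- (j - i))), (j - i); split; first exact/AJ/AV.
  by right; rewrite expgnFr // /conjg !invgM !invgK !gnorm.
have red l' : (forall m j, A m -> H (m * a ^+ j) -> span N l' (m * a ^+ j)) ->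
    {in l', forall x, H x} -> fg_mod N H.
  move=> ml' l'H; exists l'; apply/seteqP; split.
    exact: span_min.
  have [S1 SM SV] := span_subgroup N l'.
  move=> x Hx; have [m [j [Am [xE|xE]]]] := repH x Hx.
    by rewrite xE; apply: ml' => //; rewrite -xE.
  by rewrite -[x]invgK; apply: SV; rewrite xE; apply: ml' => //; rewrite -xE; exact: HV.
have lH : {in l, forall x, H x}.
  by move=> x xl; have [] : (H `&` A) x by rewrite -lE; exact: mem_span.
have [[d0 [d0gt [m0 [Am0 Hd0]]]]|noD] :=
  pselect (exists d, 0 < d /\ exists m, A m /\ H (m * a ^+ d)); last first.
  apply: (red l) => // m [|j] Am Hm.
    by rewrite lE; split=> //; rewrite expg0 mulg1.
  by case: noD; exists j.+1; split=> //; exists m.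
have ex : exists d, (0 < d) && `[< exists m, A m /\ H (m * a ^+ d) >].
  by exists d0; rewrite d0gt; apply/asboolP; exists m0.
case: (ex_minnP ex) => d /andP[dgt /asboolP[m1 [Am1 Hd]]] dmin {ex}.
set h := m1 * a ^+ d in Hd.
have sl : span N l `<=` span N (h :: l).
  apply: generatedS => x [Nx|xl]; [by left|right => /=].
  by rewrite in_cons xl orbT.
apply: (red (h :: l)) => //; last first.
  by move=> x; rewrite in_cons => /orP[/eqP->//|/lH].
move=> m j; elim/ltn_ind: j m => j IH m Am Hm.
have [S1 SM SV] := span_subgroup N (h :: l).
have [jd|dj] := ltnP j d.
  case: j jd {IH} Hm => [|j] jd Hm.
    by apply: sl; rewrite lE; split=> //; rewrite expg0 mulg1.
  have : d <= j.+1 by apply: dmin => /=; apply/asboolP; exists m.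
  by rewrite leqNgt jd.
(* One step of the division by [d]: [m2 * a ^+ (j - d)] is the quotient of
   [m * a ^+ j] by [h]. *)
set m2 := m * m1^-1 ^ (a ^- (j - d)).
have mE : m * a ^+ j = m2 * a ^+ (j - d) * h.
  rewrite /m2 /h /conjg !invgK !gnorm -!mulgA; congr (_ * _).
  by rewrite -expgnDr subnK.
rewrite mE; apply: SM; last by apply: mem_span; rewrite mem_head.
apply: IH; first by rewrite ltn_subrL dgt (leq_trans dgt dj).
  by apply: AM => //; exact/AJ/AV.
by rewrite -(mulgK h (_ * _)) -mE; apply: HM => //; exact: HV.
Qed.

(** Modulo the next term, the commutator is bilinear on a term of the lower
    central series and the whole group, so the commutators of generators
    generate. *)
Lemma lower_central_fg_mod i : finitely_generated [set: G] ->
  fg_mod (lower_central i.+1) (lower_central (G := G) i).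
Proof.
move=> /fgP[s sG]; elim: i => [|i [l lE]].
  exists s; apply/seteqP; split=> // x _.
  have : generated [set` s] x by rewrite sG.
  by apply: generatedS => y ys; right.
set L2 := lower_central i.+2; set L1 := lower_central i.+1.
pose l' := [seq [~ a, b] | a <- l, b <- s].
have lL x : x \in l -> lower_central i x by move=> xl; rewrite -lE; exact: mem_span.
have L21 : L2 `<=` L1.
  apply: generated_min; first exact: lower_central_subgroup.
  move=> _ [x [y [Lx ->]]]; have [[_ LM LV] LJ] := lower_central_normal i.+1.
  by apply: LM; [exact: LV|exact: LJ].
have l'L : span L2 l' `<=` L1.
  apply: span_min => //; first exact: lower_central_subgroup.
  by move=> _ /allpairsP[[a b] /= [al bs ->]]; apply: lower_central_comm; exact: lL.
exists l'; apply/seteqP; split=> //.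
have hL : is_normal (span L2 l').
  apply: generated_normal => x g Sx.
  have [_ SM _] := span_subgroup L2 l'.
  rewrite -(mulVKg x (x ^ g)); apply: SM; first exact: sub_generated.
  apply: sub_span; apply: lower_central_comm; apply: l'L; exact: sub_generated.
have ls : lower_central i `<=` central_mod (span L2 l').
  rewrite -lE; apply: span_min.
  - by case: (central_mod_normal hL).
  - by move=> x Lx y; apply: sub_span; exact: lower_central_comm.
  move=> x xl y; have : generated [set` s] y by rewrite sG.
  apply: (@generated_min _ [set y | span L2 l' [~ x, y]]); last first.
    by move=> z zs /=; apply: mem_span; apply/allpairsP; exists (x, z).
  have [[S1 SM SV] SJ] := hL.
  split=> [|y1 y2 h1 h2|y1 h1] /=; first by rewrite commg1.
    have -> : [~ x, y1 * y2] = [~ x, y2] * [~ x, y1] ^ y2.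
      by rewrite /commg /conjg !gnorm.
    by apply: SM => //; exact: SJ.
  have -> : [~ x, y1^-1] = ([~ x, y1]^-1) ^ y1^-1.
    by rewrite /commg /conjg !gnorm.
  by apply: SJ; apply: SV.
apply: generated_min; first by case: hL.
by move=> _ [x [y [Lx ->]]]; exact: ls.
Qed.

(** The lower central series refines, through [lower_central_fg_mod], to a
    finite chain of cyclic extensions starting at [M]. *)
Lemma noetherian_nilpotent M : finitely_generated [set: G] ->
  is_normal M -> nilpotent_mod M -> noetherian_mod M [set: G].
Proof.
move=> fG hM /(nilpotent_mod_lower hM)[n Ln].
suff noe i : i <= n -> exists A, [/\ is_normal A, M `<=` A,
    lower_central i `<=` A & noetherian_mod M A].
  have [A [_ _ TA noeA]] := noe 0 (leq0n n).
  by move=> H hH MH _; apply: noeA => // x _; exact: TA.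
move=> lein; rewrite -(subKn lein); move: (n - i) (leq_subr i n) => {i lein} k.
elim: k => [_|k IH ltkn].
  rewrite subn0; exists M; split=> // H hH MH HM; exists [::].
  apply/seteqP; split; first exact: span_min.
  by move=> x /HM; exact: sub_span.
have [A [hA MA LA noeA]] := IH (ltnW ltkn).
have [l lE] := lower_central_fg_mod (n - k.+1) fG.
move: lE; rewrite subnSK // => lE.
have lL x : x \in l -> lower_central (n - k.+1) x.
  by move=> xl; rewrite -lE; exact: mem_span.
have lc x : x \in l -> central_mod A x.
  move=> xl y; apply: LA; have := lower_central_comm y (lL _ xl).
  by rewrite subnSK.
suff [B [hB AB lB noeB]] : exists B, [/\ is_normal B, A `<=` B,
    {in l, forall x, B x} & noetherian_mod M B].
  exists B; split=> //; first by move=> x /MA/AB.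
  rewrite -lE; apply: span_min => //; first by case: hB.
  by move=> x /LA/AB.
elim: l lc {lE lL} => [|a l IHl] lc; first by exists A; split.
have [|B [hB AB lB noeB]] := IHl.
  by move=> x xl; apply: lc; rewrite in_cons xl orbT.
exists (cyclic_ext B a); split.
- apply: cyclic_ext_normal => // y; apply: AB; apply: lc; exact: mem_head.
- by move=> x /AB; exact: sub_cyclic_ext.
- move=> x; rewrite in_cons => /orP[/eqP->|/lB]; last exact: sub_cyclic_ext.
  by apply: cyclic_ext_gen; case: hB => -[].
apply: noetherian_cyclic_ext => //; [by case: hB|by move=> x /MA/AB|].
by move=> x Bx; split; exact: hB.2.
Qed.

End Subgroups.

(** * Positive cones and the isotropy of an order *)

Section OrderCones.
Variable G : groupType.
Implicit Types (lt : relation G) (A H : set G) (g h u x y : G).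

Section Order.
Variables (lt : relation G) (ltO : is_order lt).

Lemma lt_cone g h : lt g h <-> lt 1 (g^-1 * h).
Proof.
split=> [/(order_mull ltO g^-1)|/(order_mull ltO g)]; first by rewrite mulVg.
by rewrite mulg1 mulVKg.
Qed.

Lemma cone1 : ~ lt 1 1. Proof. exact: order_irr. Qed.

Lemma coneM g h : lt 1 g -> lt 1 h -> lt 1 (g * h).
Proof.
move=> g1 /(order_mull ltO g); rewrite mulg1; exact: order_trans.
Qed.

Lemma coneJ g x : lt 1 g -> lt 1 (g ^ x).
Proof.
by move=> /(order_mull ltO x^-1)/(order_mulr ltO x); rewrite mulg1 mulVg -mulgA.
Qed.

Lemma coneJE g x : lt 1 (g ^ x) <-> lt 1 g.
Proof. by split=> [/(@coneJ _ x^-1)|]; [rewrite conjgK|exact: coneJ]. Qed.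

Lemma coneX g n : lt 1 g -> lt 1 (g ^+ n.+1).
Proof.
move=> g1; elim: n => [|n IH]; first by rewrite expg1.
by rewrite expgS; exact: coneM.
Qed.

(** The stabilizer of the positive cone under right translations. *)
Definition isotropy : set G := [set u | forall g, lt 1 (g * u) <-> lt 1 g].

Lemma isotropy_normal : is_normal isotropy.
Proof.
split; first split=> [g|x y hx hy g|x hx g]; first by rewrite mulg1.
- by rewrite mulgA hy hx.
- by rewrite -(hx (g * x^-1)) mulgVK.
move=> x y hx g.
by rewrite -(coneJE _ y^-1) conjMg conjgK hx coneJE.
Qed.

Lemma isotropyl u g : isotropy u -> (lt 1 (u * g) <-> lt 1 g).
Proof.
move=> hu; rewrite -(coneJE _ u) -[X in _ <-> X](hu g).
by rewrite /conjg !gnorm.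
Qed.

Lemma isotropy_not_cone u : isotropy u -> ~ lt 1 u.
Proof. by move=> /(_ 1); rewrite mul1g => -> /cone1. Qed.

Lemma isotropy_antichain : antichain lt isotropy.
Proof.
have [[_ IM IV] _] := isotropy_normal.
by move=> s t Is It /lt_cone; apply: isotropy_not_cone; apply: IM => //; exact: IV.
Qed.

Lemma antichainP A : is_subgroup A ->
  (antichain lt A <-> forall x, A x -> ~ lt 1 x).
Proof.
move=> [A1 AM AV]; split=> [aA x Ax|nA s t As At /lt_cone]; first exact: aA.
by apply: nA; apply: AM => //; exact: AV.
Qed.

(** The order on the quotient compares arbitrary representatives; the choice
    does not matter because [N] lies in the isotropy. *)
Lemma isotropy_factor (N : normalSubgroup G) : (N : set G) `<=` isotropy ->
  exists2 ltQ : relation (quotient_group N), is_order ltQ & lt = induced_order (proj N) ltQ.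
Proof.
move=> NI; have [[I1 IM IV] IJ] := isotropy_normal.
pose ltQ : relation (quotient_group N) := fun a b => lt (repr a) (repr b).
have ltQE g h : ltQ (proj N g) (proj N h) <-> lt g h.
  have /projP/NI := reprK_proj (proj N g); have /projP/NI := reprK_proj (proj N h).
  rewrite /ltQ; set g' := repr (proj N g); set h' := repr (proj N h) => hI gI.
  have -> : lt g h <-> lt g' h.
    rewrite (lt_cone g) (lt_cone g').
    have -> : g'^-1 * h = g'^-1 * g * (g^-1 * h) by rewrite !gnorm.
    by rewrite (isotropyl _ gI).
  rewrite lt_cone (lt_cone g').
  have -> : g'^-1 * h = g'^-1 * h' * (h'^-1 * h) by rewrite !gnorm.
  by rewrite hI.
exists ltQ; last first.
  by apply/funext => g; apply/funext => h; apply/propext; rewrite /induced_order ltQE.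
split=> [a|a b|a b c|a b c|a b c].
- exact: (order_irr ltO).
- exact: (order_asym ltO).
- exact: (order_trans ltO).
- rewrite -(reprK_proj a) -(reprK_proj b) -(reprK_proj c) -!projM !ltQE.
  exact: (order_mull ltO).
- rewrite -(reprK_proj a) -(reprK_proj b) -(reprK_proj c) -!projM !ltQE.
  exact: (order_mulr ltO).
Qed.

(** An order is induced from the quotient by [A] exactly when its positive cone
    is a union of cosets of [A]. *)
Lemma factorizingP :
  factorizing lt <->
  forall A, is_normal A -> (forall x, A x -> ~ lt 1 x) -> A `<=` isotropy.
Proof.
split=> [fac A hA nA u Au g|fac N aN]; last first.
  apply: isotropy_factor; apply: fac; first exact: normalP.
  by apply/antichainP => //; exact: subgroupP.
have [|ltQ _ ->] := fac (mk_normal hA); first by apply/antichainP => //; case: hA.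
have u1 : proj (mk_normal hA) u = 1 by apply/prE1.
by rewrite /induced_order gmulfM /= u1 mulg1.
Qed.

End Order.

(** By [factorizingP] the isotropy contains all antichain normal subgroups, and
    it is itself one. *)
Lemma maximal_isotropy lt (K : normalSubgroup G) :
  is_order lt -> factorizing lt ->
  maximal_antichain_normal lt K <-> K = isotropy lt :> set G.
Proof.
move=> ltO /(factorizingP ltO) fac; have aI := isotropy_antichain ltO.
have sub A : is_normal A -> antichain lt A -> A `<=` isotropy lt.
  by move=> hA aA; apply: fac => //; apply/antichainP => //; case: hA.
split=> [[aK maxK]|KI]; last first.
  split=> [|K' aK' _]; rewrite KI //; apply: sub => //; exact: normalP.
apply/seteqP; split; first by apply: sub => //; exact: normalP.
apply: (maxK (mk_normal (isotropy_normal ltO))) => //.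
by apply: sub => //; exact: normalP.
Qed.

Definition half_space lt : set G := [set g | isotropy lt g \/ lt 1 g].

Lemma upper_setE lt : is_order lt -> upper_set lt (isotropy lt) = half_space lt.
Proof.
move=> ltO; have [[I1 IM IV] IJ] := isotropy_normal ltO.
apply/seteqP; split=> [g [k Ik [/(lt_cone ltO)|<-]]|g [Ig|Pg]].
- by right; rewrite -(isotropyl ltO g (IV _ Ik)).
- by left.
- by exists g => //; right.
- by exists 1 => //; left.
Qed.

End OrderCones.

Section Induced.
Variables (G : groupType) (N : normalSubgroup G).

Lemma induced_isotropy (ltQ : relation (quotient_group N)) g :
  isotropy (induced_order (proj N) ltQ) g <-> isotropy ltQ (proj N g).
Proof.
rewrite /isotropy /induced_order /=; split=> Ig h; last by rewrite gmulfM Ig.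
by rewrite -(reprK_proj h) -projM Ig.
Qed.

Lemma zpow_proj (Q : groupType) (f : UMagmaMorphism.type G Q) g i :
  f (zpow g i) = zpow (f g) i.
Proof. by case: i => n /=; rewrite ?gmulfV gmulfXn. Qed.

(** Being full and archimedean passes between an order and the order that it
    induces, in both directions, so only the condition on [N] remains. *)
Lemma S_ordP (lt : relation G) :
  S_ord N lt <-> nontrivial_full_archimedean lt /\ antichain lt N.
Proof.
split=> [[ltQ [ltO ntriv [prim fac] arch] ->]|[[ltO ntriv [prim fac] arch] aN]].
  have ltO' : is_order (induced_order (proj N) ltQ).
    split=> [g|g h|f g h|f g h|f g h]; rewrite /induced_order ?gmulfM.
    - exact: order_irr.
    - exact: order_asym.
    - exact: order_trans.
    - exact: order_mull.
    - exact: order_mulr.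
  have [[N1 _ _] _] := normalP N.
  split; last first.
    move=> s t Ns Nt; rewrite /induced_order /=.
    have -> : proj N s = 1 by apply/projE1.
    have -> : proj N t = 1 by apply/projE1.
    exact: order_irr.
  split=> //.
  - move=> triv; apply: ntriv => a b; rewrite -(reprK_proj a) -(reprK_proj b).
    exact: triv.
  - split=> [g h n|]; first by rewrite /induced_order !gmulfXn; exact: prim.
    apply/factorizingP => // A hA nA u Au; apply/induced_isotropy.
    have /(factorizingP ltO) fac' := fac.
    apply: (fac' (proj N @` A)); [|move|by exists u]; last first.
      move=> _ [x Ax <-]; have := nA _ Ax.
      by rewrite /induced_order gmulf1.
    have [[A1 AM AV] AJ] := hA; split; first split.
    + by exists 1 => //; rewrite gmulf1.
    + move=> _ _ [x Ax <-] [y Ay <-]; exists (x * y); first exact: AM.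
      by rewrite gmulfM.
    + by move=> _ [x Ax <-]; exists x^-1; [exact: AV|rewrite gmulfV].
    + move=> _ q [x Ax <-]; exists (x ^ repr q); first exact: AJ.
      by rewrite gmulfJ /= reprK_proj.
  - move=> [g [h [g1 gh]]]; apply: arch; exists (proj N g), (proj N h).
    split=> [|i]; first by move: g1; rewrite /positive /induced_order gmulf1.
    by rewrite -zpow_proj; exact: gh.
have [ltQ ltQO ltE] := fac N aN; exists ltQ => //; split=> //.
- by move=> triv; apply: ntriv => g h; rewrite ltE; exact: triv.
- split=> [a b n|].
    rewrite -(reprK_proj a) -(reprK_proj b) -!gmulfXn => abn.
    by have := prim (repr a) (repr b) n; rewrite ltE; apply.
  apply/factorizingP => // A hA nA a Aa.
  rewrite -(reprK_proj a); apply/induced_isotropy; rewrite -ltE.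
  have [[A1 AM AV] AJ] := hA.
  have /(factorizingP ltO) fac' := fac.
  apply: (fac' [set g | A (proj N g)]).
  + split; first split=> [|x y|x] /=; rewrite ?gmulf1 ?gmulfM ?gmulfV //; auto.
    by move=> x g; rewrite /= gmulfJ; exact: AJ.
  + by move=> x /nA; rewrite ltE /induced_order gmulf1.
  + by rewrite /= reprK_proj.
- move=> [a [b [a1 ab]]]; apply: arch; exists (repr a), (repr b).
  rewrite /positive ltE /induced_order gmulf1 /= reprK_proj; split=> // i.
  by rewrite zpow_proj /= !reprK_proj; exact: ab.
Qed.

End Induced.

Section Comparable.
Variable G : groupType.
Implicit Types (lt : relation G) (g h u x y : G).

Lemma primitive_cone lt g n : is_order lt -> primitive lt ->
  lt 1 (g ^+ n) -> lt 1 g.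
Proof. by move=> ltO prim; rewrite -{1}(expg1n _ n); exact: prim. Qed.

(** Since [(x * g) ^+ 2 = x ^+ 2 * (g ^ x * g)], this is primitivity for the
    exponent 2. *)
Lemma primitive_mul_conj lt g x : is_order lt -> primitive lt ->
  lt 1 (g ^ x * g) -> lt 1 g.
Proof.
move=> ltO prim gg; have := prim x (x * g) 2; rewrite (lt_cone ltO).
rewrite (lt_cone ltO x) mulKg; apply; rewrite !expg2.
by move: gg; rewrite /conjg !gnorm.
Qed.

(** If neither [u] nor its inverse is positive, then by primitivity no power of
    [u] is, so [u] and the isotropy generate an antichain normal subgroup. *)
Lemma central_comparable lt u : is_order lt -> primitive lt -> factorizing lt ->
  central_mod (isotropy lt) u -> [\/ isotropy lt u, lt 1 u | lt 1 u^-1].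
Proof.
move=> ltO prim /(factorizingP ltO) fac cu.
have hI := isotropy_normal ltO.
have [pu|nu] := pselect (lt 1 u); first by constructor 2.
have [pu'|nu'] := pselect (lt 1 u^-1); first by constructor 3.
constructor 1; apply: (fac _ (cyclic_ext_normal hI cu)); last first.
  by apply: cyclic_ext_gen; case: hI => -[].
move=> _ [m [i [j [Im ->]]]]; rewrite -mulgA (isotropyl ltO _ Im).
have [ji|/ltnW ij] := leqP j i.
  by rewrite -expgnFr // => /(primitive_cone ltO prim).
have -> : u ^+ i / u ^+ j = u^-1 ^+ (j - i).
  by rewrite expVgn expgnFr // invgM invgK.
by move=> /(primitive_cone ltO prim).
Qed.

End Comparable.

(** * Positive elements are central modulo the isotropy *)

Section PositiveCentral.
Variable G : groupType.
Implicit Types (lt : relation G) (g h u w x y z c : G).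

(** Products of conjugates of [g]; their number, the size of [ys], is what
    bounds them in [dominate_conj_prod]. *)
Definition conj_prod g (ys : seq G) : G := foldr (fun y r => g ^ y * r) 1 ys.

Lemma conj_prod_cat g ys zs :
  conj_prod g (ys ++ zs) = conj_prod g ys * conj_prod g zs.
Proof. by elim: ys => [|y ys IH] /=; rewrite ?mul1g // IH mulgA. Qed.

Lemma conj_prodJ g ys x :
  conj_prod g ys ^ x = conj_prod g [seq y * x | y <- ys].
Proof. by elim: ys => [|y ys IH] /=; rewrite ?conj1g // conjMg IH conjgM. Qed.

Lemma conj_prod_central g c ys : (forall x, commute c x) ->
  conj_prod (g * c) ys = conj_prod g ys * c ^+ size ys.
Proof.
move=> cc; elim: ys => [|y ys IH] /=; first by rewrite expg0 mulg1.
have -> : (g * c) ^ y = g ^ y * c by rewrite /conjg -!mulgA (cc y).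
move: (g ^ y) => t; rewrite IH expgS -!mulgA; congr (_ * _).
by rewrite !mulgA (cc (conj_prod g ys)).
Qed.

(** The number of conjugates does not depend on [x]; this uniformity is what
    [positive_central] exploits. *)
Lemma comm_conj_prod g ys zs x : exists ys' zs',
  [/\ size ys' = (size ys + size zs)%N, size zs' = (size ys + size zs)%N &
      [~ (conj_prod g ys)^-1 * conj_prod g zs, x] =
      (conj_prod g ys')^-1 * conj_prod g zs'].
Proof.
set A := conj_prod g ys; set B := conj_prod g zs.
exists ([seq y * x | y <- ys] ++ zs).
exists ([seq y * (A ^ x)^-1 | y <- ys] ++ [seq y * x | y <- zs]).
rewrite !size_cat !size_map; split=> //.
rewrite !conj_prod_cat -!conj_prodJ -/A -/B.
by rewrite /commg /conjg !gnorm.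
Qed.

Lemma upper_centralS (A B : set G) n :
  A `<=` B -> upper_central A n `<=` upper_central B n.
Proof. by move=> AB; elim: n => [|n IH] //= x Ax y; apply: IH; exact: Ax. Qed.

(** Positivity of a product of [k] conjugates of [g] can be read off from [g].
    The dominating element [X] is built by [k] doublings [X |-> X ^ y * X], each
    of which [primitive_mul_conj] can undo; a doubling squares the central
    factor, whence the exponent [2 ^ k]. *)
Lemma dominate_conj_prod lt g ys : is_order lt -> primitive lt -> lt 1 g ->
  exists X, [/\ order_le lt (conj_prod g ys) X, order_le lt g X &
    forall c, (forall x, commute c x) ->
      lt 1 (X * c ^+ (2 ^ size ys)) -> lt 1 (g * c)].
Proof.
move=> ltO prim g1; elim: ys => [|y ys [X [YX gX Xc]]] /=.
  by exists g; split=> [||c _]; [left|right|rewrite expn0 expg1].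
have X1 : lt 1 X by case: gX => [gX|<- //]; exact: (order_trans ltO g1).
have XX u v : order_le lt u X -> order_le lt v X -> order_le lt (u ^ y * v) (X ^ y * X).
  have uX u' : lt u' X -> lt (u' ^ y) (X ^ y).
    by move=> /(order_mull ltO y^-1)/(order_mulr ltO y); rewrite -!mulgA.
  move=> [uX'|->] [vX|->]; [left|left|left|by right].
  - apply: (order_trans ltO (order_mulr ltO v (uX _ uX'))).
    exact: order_mull.
  - by apply: order_mulr => //; exact: uX.
  - exact: order_mull.
exists (X ^ y * X); split.
- exact: XX.
- left; case: gX => [gX|<-].
    apply: (order_trans ltO gX); rewrite -{1}(mul1g X); apply: order_mulr => //.
    exact: coneJ.
  by rewrite -{1}(mul1g g); apply: order_mulr => //; exact: coneJ.
move=> c cc; rewrite expnS mul2n -addnn expgnDr => XXc; apply: Xc => //.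
set C := c ^+ _ in XXc *.
have CC x : commute C x by apply/commute_sym/commuteX/commute_sym.
apply: (primitive_mul_conj (x := y)) => //; move: XXc; congr lt.
rewrite conjMg; have -> : C ^ y = C by rewrite /conjg (CC y) mulKg.
move: (X ^ y) => t; rewrite -!mulgA; congr (_ * _).
by rewrite !mulgA (CC X).
Qed.

(** Suppose that [g] is positive and not central. Some product [w] of conjugates
    of [g] and of their inverses has a nontrivial central commutator
    [z = [~ w, x]], and [z] may be taken positive. Then [z ^+ s = [~ w, x ^+ s]]
    is a quotient of two products of [k] conjugates of [g], with the same [k]
    for every [s]. After dividing [g] by the largest power of [z] that keeps it
    positive, [dominate_conj_prod] bounds the ratio of two such products by
    [z ^+ (2 ^ k)], which is absurd for [s > 2 ^ k]. *)
Lemma positive_central lt g : is_order lt -> primitive lt -> archimedean lt ->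
  nilpotent_mod [set 1 : G] ->
  (forall z, (forall x, commute z x) -> [\/ z = 1, lt 1 z | lt 1 z^-1]) ->
  lt 1 g -> forall x, commute g x.
Proof.
move=> ltO prim arch [n Un] comp g1; apply: contrapT => ncg.
pose Z := central_mod [set 1 : G].
have ZP u : Z u <-> forall x, commute u x.
  by split=> Zu x; [apply/commgP/eqP/Zu|apply/eqP/commgP/Zu].
have nilZ : nilpotent_mod Z.
  exists n; apply/seteqP; split=> // x _.
  apply: (@upper_centralS [set 1]); last by rewrite Un.
  by move=> _ -> y; rewrite /= comm1g.
pose D := [set w | exists ys zs, w = (conj_prod g ys)^-1 * conj_prod g zs].
have Dcomm w x : D w -> D [~ w, x].
  move=> [ys [zs ->]]; have [ys' [zs' [_ _ ->]]] := comm_conj_prod g ys zs x.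
  by exists ys', zs'.
have Dg : D g by exists [::], [:: 1]; rewrite /= conjg1 invg1 mulg1 mul1g.
have nZg : ~ Z g by move=> /ZP.
have [w [[ys [zs wE]] nZw cw]] := central_mod_meet nilZ Dcomm Dg nZg.
have /existsNP[x1 x1P] := nZw.
have [x [/ZP zc z1]] : exists x, Z [~ w, x] /\ lt 1 [~ w, x].
  have /ZP zc := cw x1; case: (comp _ zc) => // [z1|z1]; first by exists x1.
  exists x1^-1; split=> //.
  have -> : [~ w, x1^-1] = [~ w, x1]^-1 ^ x1^-1 by rewrite /commg /conjg !gnorm.
  exact: coneJ.
set z := [~ w, x] in zc z1.
have zX s : [~ w, x ^+ s] = z ^+ s.
  elim: s => [|s IH]; first by rewrite !expg0 commg1.
  have -> : [~ w, x ^+ s.+1] = [~ w, x] * [~ w, x ^+ s] ^ x.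
    by rewrite expgSr /commg /conjg !gnorm.
  rewrite IH conjXg -/z expgS; congr (_ * _ ^+ _).
  by rewrite /conjg (zc x) mulKg.
have zVc s y : commute (z ^- s) y.
  by apply/commute_sym/commuteV/commuteX/commute_sym.
(* One more than the exponent [2 ^ k] of [dominate_conj_prod], so that
   something strictly positive is left over. *)
set k := (size ys + size zs)%N; pose s := (2 ^ k).+1.
have [ys' [zs' [sys szs]]] := comm_conj_prod g ys zs (x ^+ s).
rewrite -wE zX => /(congr1 (fun t => conj_prod g ys' * t)); rewrite mulVKg => eqP.
(* By the archimedean property [g] is not above all powers of [z]. *)
have exm : exists m, ~~ `[< lt 1 (g * z ^- m) >].
  apply: contrapT => nex; apply: arch; exists z, g; split=> // i.
  have all_m m : lt 1 (g * z ^- m).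
    by apply: contrapT => nlt; apply: nex; exists m; apply/asboolPn.
  case: i => m /=.
    by rewrite (lt_cone ltO) (zVc m g).
  apply: (order_trans ltO _ g1); rewrite (lt_cone ltO) mulg1 invgK.
  exact: coneX.
case: (ex_minnP exm) => m /asboolPn nm mmin.
case: m nm mmin => [|m] nm mmin; first by case: nm; rewrite expg0 invg1 mulg1.
have gm : lt 1 (g * z ^- m).
  by apply: contrapT => /asboolPn /mmin; rewrite ltnn.
set g' := g * z ^- m in gm.
have [X [YX _ Xc]] := dominate_conj_prod zs' ltO prim gm.
apply: nm; rewrite expgS invgM mulgA -/g'; apply: Xc.
  by move=> y; rewrite -(expg1 z); exact: zVc.
rewrite szs expVgn.
have E : conj_prod g' zs' = conj_prod g' ys' * z ^+ s.
  rewrite !conj_prod_central // szs -eqP sys -!mulgA; congr (_ * _).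
  by apply: commuteX; apply: commute_sym; exact: zVc.
have Y1 : order_le lt 1 (conj_prod g' ys').
  elim: (ys') => [|y l IH] /=; first by right.
  left; case: IH => [IH|<-]; first by apply: coneM => //; exact: coneJ.
  by rewrite mulg1; exact: coneJ.
have lt1 : lt 1 (conj_prod g' zs' / z ^+ (2 ^ k)).
  rewrite E /s expgS -!mulgA mulgV mulg1.
  by case: Y1 => [Y1|<-]; [exact: coneM|rewrite mul1g].
case: YX => [YX|<-//].
exact: (order_trans ltO lt1 (order_mulr ltO _ YX)).
Qed.

End PositiveCentral.

(** The hypotheses of [positive_central] hold in the quotient by the isotropy:
    there the isotropy of the induced order is trivial. *)
Lemma positive_central_mod (G : groupType) (lt : relation G) (N : set G) g :
  nontrivial_full_archimedean lt ->
  is_normal N -> antichain lt N -> nilpotent_mod N ->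
  lt 1 g -> central_mod (isotropy lt) g.
Proof.
move=> nfa hN aN [n Un] g1; have [ltO _ [prim fac] _] := nfa.
have hI := isotropy_normal ltO; pose K := mk_normal hI.
have NI : N `<=` isotropy lt.
  have /(factorizingP ltO) fac' := fac.
  by apply: fac' => //; apply/(antichainP ltO hN.1).
have /S_ordP[ltQ [ltQO _ [primQ facQ] archQ] ltE] :
    nontrivial_full_archimedean lt /\ antichain lt K.
  by split=> //; exact: isotropy_antichain.
have up i x : upper_central N i x -> upper_central [set 1] i (proj K x).
  elim: i x => [|i IH] x /=; first by move=> /NI Ix; apply/projE1.
  move=> Ux a; rewrite -(reprK_proj a) -gmulfR; apply: IH; exact: Ux.
have nilQ : nilpotent_mod [set 1 : quotient_group K].
  exists n; apply/seteqP; split=> // a _.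
  by rewrite -(reprK_proj a); apply: up; rewrite Un.
have cen := positive_central (g := proj K g) ltQO primQ archQ nilQ.
apply/(central_modP hI) => x; apply: cen => [a ca|]; last first.
  by move: g1; rewrite ltE /induced_order gmulf1.
have [|||] := central_comparable (u := a) ltQO primQ facQ.
- by move=> b; have /commgP/eqP -> := ca b; case: (isotropy_normal ltQO) => -[].
- rewrite -(reprK_proj a) => Ia; constructor 1; apply/projE1.
  by move/(induced_isotropy ltQ) : Ia; rewrite -ltE.
- by constructor 2.
- by constructor 3.
Qed.

(** * Connected half-spaces *)

Section Linked.
Variable G : groupType.
Implicit Types (S l : seq G) (X Y K : set G) (g x y z s : G).

Definition linked S X : relation G :=
  clos_refl_trans G (fun x y =>
    [/\ X x, X y & exists2 s, s \in S & y = x * s \/ x = y * s]).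

Lemma linked_refl S X x : linked S X x x. Proof. exact: rt_refl. Qed.

Lemma linked_trans S X x y z : linked S X x y -> linked S X y z -> linked S X x z.
Proof. exact: rt_trans. Qed.

Lemma linked_sym S X x y : linked S X x y -> linked S X y x.
Proof.
elim=> [a b [Xa Xb [s Ss ab]]|a|a b c _ ab _ bc]; last exact: rt_trans bc ab.
  by apply: rt_step; split=> //; exists s => //; case: ab; [right|left].
exact: rt_refl.
Qed.

Lemma linked_step S X x s : s \in S -> X x -> X (x * s) -> linked S X x (x * s).
Proof. by move=> Ss Xx Xxs; apply: rt_step; split=> //; exists s => //; left. Qed.

Lemma linked_sub S X Y x y : X `<=` Y -> linked S X x y -> linked S Y x y.
Proof.
move=> XY; elim=> [a b [/XY Xa /XY Xb ab]|a|a b c _ ab _ bc].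
- exact: rt_step.
- exact: rt_refl.
- exact: rt_trans ab bc.
Qed.

Lemma coarsely_connected_intro l K : K `<=` generated [set` l] -> K 1 ->
  (forall x, K x -> linked l K 1 x) -> coarsely_connected K.
Proof.
move=> Kl K1 con; exists (mk_subgroup (generated_subgroup [set` l])), [set` l]; split=> //.
move=> x y Kx Ky; have : linked l K x y.
  by apply: linked_trans (con y Ky); apply: linked_sym; exact: con.
elim=> [a b [Ka Kb [s Ss ab]]|a|a b c _ ab _ bc].
- apply: rt_step; split=> //; split; [exact: Kl|exact: Kl|].
  by exists s.
- exact: rt_refl.
- exact: rt_trans ab bc.
Qed.

Lemma coarsely_connected_elim K : coarsely_connected K ->
  exists l, K `<=` generated [set` l] /\
    forall x y, K x -> K y -> linked l K x y.
Proof.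
move=> [H [S [/finite_seqP[l ->] HE KH con]]]; exists l; rewrite HE; split=> //.
move=> x y Kx Ky; elim: (con x y Kx Ky) => [a b [Ka Kb [_ _ [s Ss ab]]]|a|a b c _ ab _ bc].
- by apply: rt_step; split=> //; exists s.
- exact: rt_refl.
- exact: rt_trans ab bc.
Qed.

Inductive word l : G -> Prop :=
| word1 : word l 1
| wordM u p : word l u -> p \in l -> word l (u * p).

Lemma word_mul l u v : word l u -> word l v -> word l (u * v).
Proof.
move=> wu; elim=> [|v' p _ IH pl]; first by rewrite mulg1.
by rewrite mulgA; apply: wordM.
Qed.

Lemma word_gen l u : u \in l -> word l u.
Proof. by move=> ul; rewrite -(mul1g u); apply: wordM => //; exact: word1. Qed.

End Linked.

Section HalfSpace.
Variables (G : groupType) (lt : relation G).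
Hypotheses (ltO : is_order lt) (prim : primitive lt) (fac : factorizing lt).
Let K := isotropy lt.
Let C := central_mod K.
Let hK : is_normal K := isotropy_normal ltO.

Lemma half_spaceM x y : half_space lt x -> half_space lt y -> half_space lt (x * y).
Proof.
move=> [Kx|Px] [Ky|Py].
- by left; case: hK => -[_ KM _] _; exact: KM.
- by right; rewrite (isotropyl ltO _ Kx).
- by right; rewrite (Ky x).
- by right; exact: coneM.
Qed.

(** Modulo the isotropy [K], an element [g] of the half-space is a quotient
    [a * b^-1] of two products of positive generators. The path climbs from 1
    to [a], moves within the coset [a * K], and descends to [g]; the descent
    stays in the half-space because read backwards it climbs from [g]. *)
Lemma half_space_coarsely_connected : finitely_generated K -> fg_mod K C ->
  (forall g, lt 1 g -> C g) -> coarsely_connected (half_space lt).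
Proof.
move=> /fgP[lK KE] [l CE] PC; have [[K1 KM KV] KJ] := hK.
have [[C1 CM CV] CJ] := central_mod_normal hK.
have lC x : x \in l -> C x by move=> xl; rewrite -CE; exact: mem_span.
(* Generators of the relative centre, made positive by inversion; those
   in the isotropy are dropped. *)
pose pos u := if `[< lt 1 u >] then u else if `[< lt 1 u^-1 >] then u^-1 else 1.
have posW u : half_space lt (pos u).
  rewrite /pos; case: asboolP => [|_]; first by right.
  by case: asboolP => [|_]; [right|left].
pose lP := map pos l; pose S := lK ++ lP; pose W := half_space lt.
have W1 : W 1 by left.
have lPW p : p \in lP -> W p by move=> /mapP[u _ ->]; exact: posW.
have CD u : C u -> exists a b, [/\ word lP a, word lP b & pr hK (u * b) = pr hK a].
  rewrite -CE => Cu.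
  pose B := [set u | C u /\
    exists a b, [/\ word lP a, word lP b & pr hK (u * b) = pr hK a]].
  suff /(_ u Cu)[] : span K l `<=` B by [].
  apply: span_min.
  - split=> [|x y [Cx [a [b [wa wb xa]]]] [Cy [a' [b' [wa' wb' ya]]]]|x [Cx [a [b [wa wb xa]]]]].
    + by split=> //; exists 1, 1; split; [exact: word1|exact: word1|rewrite mulg1].
    + split; first exact: CM.
      exists (a' * a), (b' * b); split; [exact: word_mul|exact: word_mul|].
      have -> : x * y * (b' * b) = x * (y * b') * b by rewrite !mulgA.
      move/(central_modP hK): Cx => cx.
      by rewrite prM (prM _ x) ya (cx a') -mulgA -(prM _ x b) xa prM.
    + split; first exact: CV.
      by exists b, a; split=> //; rewrite prM prV -xa prM mulKg.
  - move=> x Kx; split; first exact: (sub_central_mod hK).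
    exists 1, 1; split; [exact: word1|exact: word1|].
    by rewrite mulg1; apply/prP; rewrite mulg1; exact: KV.
  - move=> x xl; have Cx := lC _ xl; split=> //.
    have posl : pos x \in lP by exact: map_f.
    move: posl; rewrite /pos; case: asboolP => [Px|nPx] xP.
      by exists x, 1; split; [exact: word_gen|exact: word1|rewrite mulg1].
    move: xP; case: asboolP => [Px|nPx'] xP.
      by exists 1, x^-1; split; [exact: word1|exact: word_gen|rewrite mulgV].
    exists 1, 1; split; [exact: word1|exact: word1|].
    rewrite mulg1; apply/prP; rewrite mulg1; apply: KV.
    by case: (central_comparable ltO prim fac Cx).
have linkK k g : K k -> W g -> W (g * k) /\ linked S W g (g * k).
  rewrite -KE => gk; move: g.
  suff [_] : K k /\ forall g, W g -> W (g * k) /\ linked S W g (g * k) by apply.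
  have WK x g : K x -> W g -> W (g * x) by move=> Kx Wg; apply: half_spaceM => //; left.
  move: k gk; apply: generated_min.
    split=> [|x y [Kx hx] [Ky hy]|x [Kx hx]].
    - by split=> // g; rewrite mulg1; split=> //; exact: linked_refl.
    - split=> [|g Wg]; first exact: KM.
      have [Wgx gx] := hx g Wg; have [Wgxy gxy] := hy _ Wgx.
      by rewrite mulgA; split=> //; exact: linked_trans gxy.
    - split=> [|g Wg]; first exact: KV.
      have Wgx := WK _ _ (KV _ Kx) Wg; split=> //.
      by have [_ /linked_sym] := hx _ Wgx; rewrite mulgVK.
  move=> x xl; have Kx : K x by rewrite -KE; exact: sub_generated.
  split=> // g Wg; have Wgx := WK _ _ Kx Wg; split=> //.
  by apply: linked_step => //; rewrite mem_cat xl.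
have linkP u g : word lP u -> W g -> W (g * u) /\ linked S W g (g * u).
  move=> wu Wg; elim: wu => [|v p _ [Wv gv] pl].
    by rewrite mulg1; split=> //; exact: linked_refl.
  have Wgvp : W (g * (v * p)) by rewrite mulgA; apply: half_spaceM => //; exact: lPW.
  split=> //; apply: linked_trans gv _; rewrite mulgA in Wgvp *.
  by apply: linked_step => //; rewrite mem_cat pl orbT.
have WC g : W g -> C g.
  by move=> [Kg|Pg]; [exact: (sub_central_mod hK Kg)|exact: PC].
apply: (@coarsely_connected_intro _ S) => //.
  move=> g /WC; rewrite -CE; move: g; have hS := generated_subgroup [set` S].
  have KS : K `<=` generated [set` S].
    by rewrite -KE; apply: generatedS => x /= xl; rewrite mem_cat xl.
  apply: span_min => // x xl.
  have : pos x \in S by rewrite mem_cat map_f ?orbT.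
  have [_ _ SV] := hS.
  rewrite /pos; case: asboolP => [_ xS|nPx]; first exact: sub_generated.
  case: asboolP => [_ xS|nPx' _].
    by rewrite -(invgK x); apply: SV; exact: sub_generated.
  by apply: KS; case: (central_comparable ltO prim fac (lC _ xl)).
move=> g Wg; have [a [b [wa wb gba]]] := CD g (WC _ Wg).
have [Wgb ggb] := linkP b g wb Wg; have [Wa la] := linkP a 1 wa W1.
rewrite mul1g in Wa la.
apply: linked_trans la _; apply: linked_trans (linked_sym ggb).
have Kab : K (a^-1 * (g * b)) by apply/(prP hK).
by have [_] := linkK _ _ Kab Wa; rewrite mulVKg.
Qed.

End HalfSpace.

(** All subgroups containing [N] are finitely generated, in particular the
    isotropy of the order and its relative centre. *)
Lemma Sigma1_of_finitely_generated (G : groupType) (N : normalSubgroup G) :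
  nilpotent_mod N -> noetherian_mod N [set: G] -> finitely_generated N ->
  S_ord N `<=` @Sigma1_ord G.
Proof.
move=> nil noe fN lt /S_ordP[nfa aN]; split=> // K.
have [ltO _ [prim fac] _] := nfa; have hI := isotropy_normal ltO.
have NI : N `<=` isotropy lt.
  have /(factorizingP ltO) fac' := fac.
  apply: fac'; first exact: normalP.
  by apply/(antichainP ltO (subgroupP N)).
move=> /(maximal_isotropy _ ltO fac) ->; rewrite upper_setE //.
apply: half_space_coarsely_connected => //.
- by apply: fg_mod_fg fN; apply: noe => //; case: hI.
- have hC := central_mod_normal hI.
  have [l lE] : fg_mod N (central_mod (isotropy lt)).
    apply: noe => //; [by case: hC|by move=> x /NI; exact: (sub_central_mod hI)].
  exists l; apply/seteqP; split.
    apply: span_min; [by case: hC|exact: (sub_central_mod hI)|].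
    by move=> x xl; rewrite -lE; exact: mem_span.
  by rewrite -lE; apply: generatedS => x [/NI|]; [left|right].
- by move=> g; apply: (positive_central_mod nfa (normalP N)).
Qed.

(** * Schreier generators, maximal counterexamples, restriction to subgroups *)

Section Schreier.
Variable G : groupType.
Implicit Types (S l r : seq G) (X N M : set G) (g a u x y s : G).

Lemma linked_generated l x : generated [set` l] x -> linked l (generated [set` l]) 1 x.
Proof.
set X := generated _; have [X1 XM XV] : is_subgroup X := generated_subgroup _.
suff sub : X `<=` [set x | X x /\ forall g, X g -> linked l X g (g * x)].
  by move=> /sub[_ /(_ 1 X1)]; rewrite mul1g.
apply: generated_min; last first.
  move=> s sl; have Xs : X s by exact: sub_generated.
  by split=> // g Xg; apply: linked_step => //; exact: XM.
split=> [|y z [Xy hy] [Xz hz]|y [Xy hy]].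
- by split=> // g _; rewrite mulg1; exact: linked_refl.
- split=> [|g Xg]; first exact: XM.
  by rewrite mulgA; apply: linked_trans (hy _ Xg) (hz _ (XM _ _ Xg Xy)).
- split=> [|g Xg]; first exact: XV.
  by have /linked_sym := hy _ (XM _ _ Xg (XV _ Xy)); rewrite mulgVK.
Qed.

(** If [X] is covered by finitely many cosets of [N], then walking inside [X]
    and correcting each step by the chosen representatives writes an element of
    [N] as a product of elements [a * s * b^-1] of [N], of which there are
    finitely many. *)
Lemma schreier N S X r : is_subgroup N ->
  (forall g, X g -> exists2 a, a \in r & N (g * a^-1)) ->
  (forall n, N n -> linked S X 1 n) -> finitely_generated N.
Proof.
move=> [N1 NM NV] rep con.
(* Including 1 among the representatives and the steps provides the
   generators needed at the two ends of a walk. *)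
pose r' := 1 :: r; pose S' := 1 :: S ++ [seq s^-1 | s <- S].
pose prods := [seq y * b^-1 | y <- [seq a * s | a <- r', s <- S'], b <- r'].
pose gens := [seq x <- prods | `[< N x >]].
have gensP a s b : a \in r' -> s \in S' -> b \in r' -> N (a * s * b^-1) ->
    generated [set` gens] (a * s * b^-1).
  move=> ar sS br Nasb; apply: sub_generated => /=; rewrite mem_filter.
  apply/andP; split; first exact/asboolP.
  apply/allpairsP; exists (a * s, b); split=> //.
  by apply/allpairsP; exists (a, s).
have [g1 gM gV] := generated_subgroup [set` gens].
have S'1 : 1 \in S' by exact: mem_head.
have S's s : s \in S -> s \in S' by move=> sS; rewrite in_cons mem_cat sS !orbT.
have S'V s : s \in S -> s^-1 \in S'.
  by move=> sS; rewrite in_cons mem_cat map_f ?orbT.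
pose Inv g := exists a, [/\ a \in r', N (g * a^-1) & generated [set` gens] (g * a^-1)].
have InvS g s : s \in S' -> X (g * s) -> Inv g -> Inv (g * s).
  move=> sS /rep[b br Ngsb] [a [ar Nga gga]].
  have br' : b \in r' by rewrite in_cons br orbT.
  have E : g * s * b^-1 = g * a^-1 * (a * s * b^-1) by rewrite !gnorm.
  exists b; split=> //; rewrite E; apply: gM => //; apply: gensP => //.
  have -> : a * s * b^-1 = (g * a^-1)^-1 * (g * s * b^-1) by rewrite !gnorm.
  by apply: NM => //; exact: NV.
have link x y : linked S X x y -> Inv x -> Inv y.
  elim=> [{}x {}y [Xx Xy [s sS [yE|xE]]]|//|? ? ? _ h1 _ h2 /h1/h2 //].
    by rewrite yE in Xy *; apply: InvS => //; exact: S's.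
  have yE : y = x * s^-1 by rewrite xE mulgK.
  by rewrite yE in Xy *; apply: InvS => //; exact: S'V.
apply/fgP; exists gens; apply/seteqP; split.
  by apply: generated_min => // x /=; rewrite mem_filter => /andP[/asboolP].
move=> n Nn; have [] := link _ _ (con n Nn).
  by exists 1; rewrite mem_head mulgV.
move=> a [ar Nna gna]; have Na : N a.
  have -> : a = (n * a^-1)^-1 * n by rewrite !gnorm.
  by apply: NM => //; exact: NV.
rewrite -(mulgVK a n); apply: gM => //.
have := gensP a 1 1 ar S'1 (mem_head _ _); rewrite invg1 !mulg1; exact.
Qed.

(** The case of [schreier] in which the coset representatives are the first [e]
    powers of [u]. *)
Lemma finitely_generated_cyclic_ext M u e : is_normal M -> central_mod M u ->
  (0 < e)%N -> M (u ^+ e) -> finitely_generated (cyclic_ext M u) ->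
  finitely_generated M.
Proof.
move=> hM cu egt Mue /fgP[l lE].
apply: (@schreier M l (cyclic_ext M u) [seq u ^+ i | i <- iota 0 e]).
- by case: hM.
- move=> _ [m [i [j [Mm ->]]]].
  (* Modulo [e], the exponent [- j] is [j * e.-1]. *)
  pose k := ((i + j * e.-1) %% e)%N; exists (u ^+ k).
    by apply: map_f; rewrite mem_iota ltn_mod.
  apply/(prE1 hM).
  have v1 : pr hM u ^+ e = 1 by rewrite /pr -gmulfXn; apply/prE1.
  have vX n : pr hM u ^+ (n * e) = 1 by rewrite mulnC expgnA v1 expg1n.
  have m1 : pr hM m = 1 by apply/prE1.
  have prX n : pr hM (u ^+ n) = pr hM u ^+ n by exact: gmulfXn.
  rewrite !(prM, prV, prX) m1 mul1g.
  have kE : pr hM u ^+ (i + j * e.-1) = pr hM u ^+ k.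
    by rewrite [in LHS](divn_eq (i + j * e.-1) e) expgnDr vX mul1g.
  have jE : pr hM u ^- j = pr hM u ^+ (j * e.-1).
    apply: mulg1_eq; rewrite -expgnDr -mulnS prednK // ; exact: vX.
  by rewrite jE -expgnDr kE mulgV.
- move=> n Mn; have {Mn} : cyclic_ext M u n by exact: sub_cyclic_ext.
  by rewrite -lE; exact: linked_generated.
Qed.

End Schreier.

(** Zorn's lemma applies because a union of a chain of subgroups that is
    generated by a finite set is equal to one member of the chain. *)
Lemma maximal_not_fg (G : groupType) (N : set G) : is_normal N ->
  ~ finitely_generated N ->
  exists M, [/\ is_normal M, N `<=` M, ~ finitely_generated M &
    forall M', is_normal M' -> M `<=` M' -> ~ M' `<=` M -> finitely_generated M'].
Proof.
move=> hN nN; pose P X := is_normal (N `|` X) /\ ~ finitely_generated (N `|` X).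
have [|A [[hA nA] maxA]] := @Zorn_bigcup G P; last first.
  exists (N `|` A); split=> [//||//|M' hM' AM' nM'A]; first by move=> x; left.
  apply: contrapT => nM'; apply: (maxA M').
    rewrite /proper; split=> [x Ax|M'A]; first by apply: AM'; right.
    by apply: nM'A => x /M'A; right.
  suff E : N `|` M' = M' by rewrite /P E.
  by apply/seteqP; split=> x; [move=> [Nx|//]; apply: AM'; left|right].
move=> F FP tot.
have [[X0 FX0]|F0] := pselect (exists X, F X); last first.
  suff -> : \bigcup_(X in F) X = set0 by rewrite /P setU0.
  by apply/seteqP; split=> // x [X FX]; case: F0; exists X.
set U := \bigcup_(X in F) X.
have NU x : (N `|` U) x -> exists2 X, F X & (N `|` X) x.
  by move=> [Nx|[X FX Xx]]; [exists X0 => //; left|exists X => //; right].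
have UN X : F X -> N `|` X `<=` N `|` U.
  by move=> FX x [Nx|Xx]; [left|right; exists X].
have comp X Y : F X -> F Y -> exists2 Z, F Z & N `|` X `<=` N `|` Z /\ N `|` Y `<=` N `|` Z.
  move=> FX FY; case: (tot _ _ FX FY) => XY.
    by exists Y => //; split=> // x [Nx|/XY]; [left|right].
  by exists X => //; split=> // x [Nx|/XY]; [left|right].
split.
  split; first split.
  - by left; case: hN => -[].
  - move=> x y /NU[X FX Xx] /NU[Y FY Yy]; have [Z FZ [XZ YZ]] := comp _ _ FX FY.
    have [[[_ ZM _] _] _] := FP _ FZ.
    by apply: (UN _ FZ); apply: ZM; [exact: XZ|exact: YZ].
  - move=> x /NU[X FX Xx]; have [[[_ _ XV] _] _] := FP _ FX.
    by apply: (UN _ FX); exact: XV.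
  - move=> x g /NU[X FX Xx]; have [[_ XJ] _] := FP _ FX.
    by apply: (UN _ FX); exact: XJ.
move=> /fgP[l lE].
have [X FX lX] : exists2 X, F X & {in l, forall x, (N `|` X) x}.
  have : {in l, forall x, (N `|` U) x}.
    by move=> x xl; rewrite -lE; exact: sub_generated.
  elim: (l) => [_|x l' IH lU]; first by exists X0.
  have [|X FX Xl] := IH; first by move=> y yl; apply: lU; rewrite in_cons yl orbT.
  have [Y FY Yx] := NU x (lU x (mem_head _ _)).
  have [Z FZ [XZ YZ]] := comp _ _ FX FY.
  exists Z => // y; rewrite in_cons => /orP[/eqP->|/Xl]; [exact: YZ|exact: XZ].
have [[hX _] nX] := FP _ FX; apply: nX; apply/fgP; exists l.
apply/seteqP; split; first exact: generated_min.
by rewrite lE; exact: UN.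
Qed.

Lemma image_generated (G1 G2 : groupType) (f : UMagmaMorphism.type G1 G2) (S : set G1) :
  f @` generated S = generated (f @` S).
Proof.
have [g1 gM gV] := generated_subgroup S.
have [h1 hM hV] := generated_subgroup (f @` S).
apply/seteqP; split.
  move=> _ [x gx <-]; move: x gx.
  apply: (@generated_min _ _ [set x | generated (f @` S) (f x)]).
    by split=> [|x y|x] /=; rewrite ?gmulf1 ?gmulfM ?gmulfV; auto.
  by move=> x Sx; apply: sub_generated; exists x.
apply: generated_min; last by move=> _ [x Sx <-]; exists x => //; exact: sub_generated.
split.
- by exists 1 => //; rewrite gmulf1.
- by move=> _ _ [x gx <-] [y gy <-]; exists (x * y); [exact: gM|rewrite gmulfM].
- by move=> _ [x gx <-]; exists x^-1; [exact: gV|rewrite gmulfV].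
Qed.

Lemma finitely_generated_image (G1 G2 : groupType) (f : UMagmaMorphism.type G1 G2)
    (A : set G1) :
  finitely_generated A -> finitely_generated (f @` A).
Proof.
move=> [S [Sfin <-]]; exists (f @` S); split; first exact: finite_image.
by rewrite image_generated.
Qed.

Section SubgroupTransfer.
Variables (G : groupType) (H : subgroup G).
Notation T := (subgroup_type H).
Implicit Types (A : set T) (B K : set G).

Lemma inclusionP (x : T) : subgroup_set H (inclusion x).
Proof. by case: x => x Hx; exact: set_mem. Qed.

Lemma inclusion_lift x : subgroup_set H x -> exists y : T, inclusion y = x.
Proof. by move=> /mem_set Hx; exists (exist _ x Hx). Qed.

Lemma inclusion_inj : injective (@inclusion G H).
Proof. exact: val_inj. Qed.

Lemma inclusion_lift_seq (l : seq G) : {in l, forall x, subgroup_set H x} ->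
  exists l' : seq T, map (@inclusion G H) l' = l.
Proof.
elim: l => [|x l IH] lH; first by exists [::].
have [|l' l'E] := IH; first by move=> y yl; apply: lH; rewrite in_cons yl orbT.
have [y yE] := inclusion_lift (lH x (mem_head _ _)).
by exists (y :: l') => /=; rewrite yE l'E.
Qed.

Lemma finitely_generated_preimage B : B `<=` subgroup_set H ->
  finitely_generated B -> finitely_generated ((@inclusion G H) @^-1` B).
Proof.
move=> BH /fgP[l lE]; have [|l' l'E] := @inclusion_lift_seq l.
  by move=> x xl; apply: BH; rewrite -lE; exact: sub_generated.
apply/fgP; exists l'.
have E : (@inclusion G H) @` generated [set` l'] = B.
  rewrite image_generated -lE; congr generated; apply/seteqP; split=> x.
    by move=> [y yl <-]; rewrite /= -l'E; exact: map_f.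
  by rewrite /= -l'E => /mapP[y yl ->]; exists y.
rewrite -E; apply/seteqP; split=> x /=; first by exists x.
by move=> [y gy /inclusion_inj <-].
Qed.

(** A step between two elements of [H] is made by a generator that lies in
    [H]. *)
Lemma coarsely_connected_preimage K : K `<=` subgroup_set H -> K 1 ->
  coarsely_connected K -> coarsely_connected ((@inclusion G H) @^-1` K).
Proof.
move=> KH K1 /coarsely_connected_elim[l [_ con]].
have [|l' l'E] := @inclusion_lift_seq [seq s <- l | `[< subgroup_set H s >]].
  by move=> x; rewrite mem_filter => /andP[/asboolP].
have [g1 gM gV] := generated_subgroup [set` l'].
have lift x y : linked l K x y -> forall x', inclusion x' = x -> exists y',
    [/\ inclusion y' = y, linked l' ((@inclusion G H) @^-1` K) x' y' &
        generated [set` l'] (x'^-1 * y')].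
  elim=> [{}x {}y [Kx Ky [s sl xyE]]|{}x|{}x {}y z _ h1 _ h2] x' x'E; last first.
  - have [y' [y'E xy gxy]] := h1 _ x'E; have [z' [z'E yz gyz]] := h2 _ y'E.
    exists z'; split=> //; first exact: linked_trans yz.
    by have := gM _ _ gxy gyz; rewrite -mulgA mulVKg.
  - by exists x'; split=> //; [exact: linked_refl|rewrite mulVg].
  have [y' y'E] := inclusion_lift (KH _ Ky); exists y'.
  have [s' s'l sE] : exists2 s', s' \in l' & y' = x' * s' \/ x' = y' * s'.
    have Hs : subgroup_set H s.
      have Hx := KH _ Kx; have Hy := KH _ Ky; case: xyE => E.
        by rewrite -(mulKg x s) -E; apply: subgroupM => //; exact: subgroupV.
      by rewrite -(mulKg y s) -E; apply: subgroupM => //; exact: subgroupV.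
    have : s \in map (@inclusion G H) l'.
      by rewrite l'E mem_filter sl andbT; apply/asboolP.
    move=> /mapP[s' s'l sE]; exists s' => //; move: xyE; rewrite sE -x'E -y'E.
    by rewrite -!gmulfM => -[/inclusion_inj|/inclusion_inj]; [left|right].
  split=> //.
    by apply: rt_step; split; rewrite /= ?x'E ?y'E //; exists s'.
  have gs : generated [set` l'] s' by exact: sub_generated.
  by case: sE => ->; [rewrite mulKg|rewrite invgM mulgVK; exact: gV].
have lift1 x' : K (inclusion x') -> linked l' ((@inclusion G H) @^-1` K) 1 x' /\
    generated [set` l'] x'.
  move=> Kx; have [|y' [/inclusion_inj -> ?]] := lift _ _ (con 1 _ K1 Kx) 1.
    exact: gmulf1.
  by rewrite invg1 mul1g.
apply: (@coarsely_connected_intro _ l').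
- by move=> x /lift1[].
- by rewrite /= gmulf1.
- by move=> x /lift1[].
Qed.

End SubgroupTransfer.

(** * Integer coordinates on an abelian quotient *)

Section AbelianQuotient.
Variables (G : groupType) (N : set G) (hN : is_normal N).
Hypothesis abN : forall x y, N [~ x, y].

(** The abelian quotient, as a type of its own that can carry the additive
    structure; commutativity is passed as an argument so that the structure can
    be inferred. *)
Definition ab_quotient (_ : forall x y, N [~ x, y]) : Type := quotient_group (mk_normal hN).
Notation A := (ab_quotient abN).

HB.instance Definition _ := Choice.on A.

Let addA : associative (fun x y : A => (x : quotient_group _) * y).
Proof. exact: mulgA. Qed.

Let addC : commutative (fun x y : A => (x : quotient_group _) * y).
Proof.
move=> x y; rewrite -(reprK_proj x) -(reprK_proj y).
have /(central_modP hN)/(_ (repr y)) : central_mod N (repr x) by move=> z; exact: abN.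
exact.
Qed.

Let add0 : left_id (1 : quotient_group (mk_normal hN))
  (fun x y : A => (x : quotient_group _) * y).
Proof. exact: mul1g. Qed.

Let addN : left_inverse (1 : quotient_group (mk_normal hN))
  (fun x : A => (x : quotient_group _)^-1)
  (fun x y : A => (x : quotient_group _) * y).
Proof. exact: mulVg. Qed.

HB.instance Definition _ := GRing.isZmodule.Build A addA addC add0 addN.

Definition ab_proj (g : G) : A := pr hN g.

Lemma ab_projM x y : ab_proj (x * y) = (ab_proj x + ab_proj y)%R.
Proof. exact: prM. Qed.

Lemma ab_proj_eq0 x : ab_proj x = 0%R <-> N x.
Proof. exact: prE1. Qed.

Lemma ab_projV x : ab_proj x^-1 = (- ab_proj x)%R.
Proof. exact: prV. Qed.

Lemma ab_projX x n : ab_proj (x ^+ n) = (ab_proj x *+ n)%R.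
Proof.
elim: n => [|n IH]; first by rewrite expg0 mulr0n; apply/ab_proj_eq0; case: hN => -[].
by rewrite expgS ab_projM IH mulrS.
Qed.

End AbelianQuotient.

Section IndependentGenerators.
Local Open Scope ring_scope.
Variables (A : zmodType) (n : nat) (a : 'I_n -> A).
Implicit Types (v w : 'rV[int]_n) (B : {set 'I_n}).

Definition int_comb v : A := \sum_i a i *~ v 0 i.

Lemma int_combD v w : int_comb (v + w) = int_comb v + int_comb w.
Proof. by rewrite -big_split; apply: eq_bigr => i _; rewrite mxE mulrzDr. Qed.

Lemma int_combN v : int_comb (- v) = - int_comb v.
Proof. by rewrite -sumrN; apply: eq_bigr => i _; rewrite mxE mulrNz. Qed.

Lemma int_comb0 : int_comb 0 = 0.
Proof. by rewrite /int_comb big1 // => i _; rewrite mxE mulr0z. Qed.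

Lemma int_combZ (z : int) v : int_comb (z *: v) = int_comb v *~ z.
Proof.
by rewrite /int_comb mulrz_suml; apply: eq_bigr => i _; rewrite mxE mulrC mulrzA.
Qed.

Lemma int_comb_delta i : int_comb (delta_mx 0 i) = a i.
Proof.
rewrite /int_comb (bigD1 i) //= big1 => [|j ji]; first by rewrite mxE !eqxx addr0.
by rewrite mxE eqxx (negbTE ji).
Qed.

Definition supported B v : Prop := forall i, i \notin B -> v 0 i = 0.

Definition independent B : Prop :=
  forall v, supported B v -> int_comb v = 0 -> v = 0.

(** A maximal independent subfamily of the generators spans a subgroup that
    contains a nonzero multiple of every generator; [e] is a common multiple of
    these factors. *)
Lemma independent_coordinates : exists B e, [/\ (0 < e)%N, independent B &
  forall v, exists2 w, supported B w & int_comb v *+ e = int_comb w].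
Proof.
pose P B := `[< independent B >].
have P0 : P finset.set0.
  by apply/asboolP => v sv _; apply/rowP => i; rewrite mxE sv // inE.
have [B /maxsetP[/asboolP indB maxB] _] := maxset_exists P0.
have suppD v w : supported B v -> supported B w -> supported B (v + w).
  by move=> sv sw i iB; rewrite mxE sv // sw // addr0.
have suppZ (z : int) v : supported B v -> supported B (z *: v).
  by move=> sv i iB; rewrite mxE sv // mulr0.
have /choice[e eP] : forall j, exists e : nat, (0 < e)%N /\
    exists2 w, supported B w & a j *+ e = int_comb w.
  move=> j; have [jB|jB] := boolP (j \in B).
    exists 1%N; split=> //; exists (delta_mx 0 j); last by rewrite int_comb_delta mulr1n.
    by move=> i iB; rewrite mxE eqxx; case: eqP iB => // ->; rewrite jB.
  have nind : ~ independent (j |: B)%SET.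
    move=> /asboolP ind; have := maxB _ ind (finset.subsetUr _ _) => BE.
    by rewrite -BE setU11 in jB.
  have /existsNP[v /not_implyP[sv /not_implyP[v0 vn0]]] := nind.
  have vj : v 0 j != 0.
    apply/eqP => vj0; apply: vn0; apply: indB => // i iB.
    by have [->//|ij] := eqVneq i j; apply: sv; rewrite !inE negb_or ij.
  exists (absz (v 0 j)); split; first by rewrite absz_gt0.
  (* Solve the relation [v] for the [j]th generator. *)
  pose w := v 0 j *: delta_mx 0 j - v.
  have wE : int_comb w = a j *~ v 0 j.
    by rewrite int_combD int_combN v0 subr0 int_combZ int_comb_delta.
  have sw : supported B w.
    move=> i iB; rewrite !mxE eqxx; have [->|ij] := eqVneq i j; first by rewrite mulr1 subrr.
    by rewrite mulr0 sub0r sv ?oppr0 // !inE negb_or ij.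
  (* The sign turns the coefficient of the [j]th generator into its absolute
     value. *)
  exists (sgz (v 0 j) *: w); first exact: suppZ.
  by rewrite int_combZ wE -mulrzA (mulrC (v 0 j)) -abszEsg pmulrn.
pose E := (\prod_j e j)%N; exists B, E; split=> //.
  by apply/prodn_gt0 => j; case: (eP j).
move=> v; rewrite {1}/int_comb.
elim/big_ind: _ => [|x y [w1 s1 E1] [w2 s2 E2]|i _].
- by exists 0; [move=> i _; rewrite mxE|rewrite mul0rn int_comb0].
- by exists (w1 + w2); [exact: suppD|rewrite mulrnDl E1 E2 int_combD].
have [_ [w sw wE]] := eP i; exists ((v 0 i * (\prod_(j | j != i) e j)%N%:Z) *: w).
  exact: suppZ.
rewrite int_combZ -wE /E (bigD1 i) //= !pmulrn -!mulrzA PoszM.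
by rewrite mulrCA.
Qed.

End IndependentGenerators.

Section Coordinates.
Variables (G : groupType) (N : set G) (hN : is_normal N).
Hypotheses (abN : forall x y, N [~ x, y]) (fgG : fg_mod N [set: G]).

(** The coordinates of [e] times the image of [x] along a maximal independent
    subfamily of the generators are additive, and they vanish only on torsion.
    Each coordinate axis is either met by the image or orthogonal to it. *)
Lemma coordinates : exists n (lam : G -> 'rV[int]_n),
  [/\ forall x y, lam (x * y) = (lam x + lam y)%R,
      forall x, N x -> lam x = 0%R,
      forall x, lam x = 0%R -> exists2 e, (0 < e)%N & N (x ^+ e) &
      forall i, (exists g c, (0 < c)%R /\ lam g = (c *: delta_mx 0 i)%R) \/
                (forall g, lam g 0%R i = 0%R)].
Proof.
have [l lE] := fgG.
pose A := ab_quotient hN abN; pose p : G -> A := ab_proj hN abN.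
pose a i : A := p (tnth (in_tuple l) i).
have comb g : exists v, p g = int_comb a v.
  have : span N l g by rewrite lE.
  apply: (@span_min _ _ _ [set g | exists v, p g = int_comb a v]).
    split=> [|x y [v vE] [w wE]|x [v vE]] /=.
    - by exists 0%R; rewrite int_comb0; apply/ab_proj_eq0; case: hN => -[].
    - by exists (v + w)%R; rewrite int_combD -vE -wE; exact: ab_projM.
    - by exists (- v)%R; rewrite int_combN -vE; exact: ab_projV.
  - by move=> x Nx; exists 0%R; rewrite int_comb0; apply/ab_proj_eq0.
  move=> x /= /seq_tnthP[i ->]; exists (delta_mx 0%R i).
  by rewrite int_comb_delta.
have [B [e [e0 indB BE]]] := independent_coordinates a.
have /choice[lam lamP] g : exists w, supported B w /\ (p g *+ e)%R = int_comb a w.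
  by have [v ->] := comb g; have [w sw ->] := BE v; exists w.
have uniq v w : supported B v -> supported B w -> int_comb a v = int_comb a w -> v = w.
  move=> sv sw vw; apply/eqP; rewrite -GRing.subr_eq0; apply/eqP; apply: indB.
    by move=> i iB; rewrite !mxE sv // sw // GRing.subr0.
  by rewrite int_combD int_combN vw subrr.
exists _, lam; split.
- move=> x y; have [sx xE] := lamP x; have [sy yE] := lamP y.
  have [sxy xyE] := lamP (x * y).
  apply: uniq => //; first by move=> i iB; rewrite mxE sx // sy // addr0.
  by rewrite int_combD -xE -yE -xyE -mulrnDl; congr (_ *+ _)%R; exact: ab_projM.
- move=> x Nx; have [sx xE] := lamP x; apply: indB => //.
  by rewrite -xE (_ : p x = 0%R) ?mul0rn //; apply/ab_proj_eq0.
- move=> x x0; have [_] := lamP x; rewrite x0 int_comb0 => xe.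
  by exists e => //; apply/(ab_proj_eq0 hN abN); rewrite ab_projX.
- move=> i; have [iB|iB] := boolP (i \in B); last first.
    by right=> g; have [sg _] := lamP g; rewrite sg.
  left; exists (tnth (in_tuple l) i), (Posz e); split=> //.
  have [s sE] := lamP (tnth (in_tuple l) i); apply: uniq => //.
    move=> j jB; have /negbTE ji : j != i by apply: contraNneq jB => ->.
    by rewrite !mxE ji andbF mulr0.
  by rewrite -sE int_combZ int_comb_delta pmulrn.
Qed.

End Coordinates.

(** * Orders defined by a limit direction *)

Lemma cone_order_nfa (G : groupType) (P : set G) :
  ~ P 1 -> (forall x y, P x -> P y -> P (x * y)) -> (forall x g, P x -> P (x ^ g)) ->
  (exists g, P g) ->
  (forall g h n, (0 < n)%N -> P ((g ^+ n)^-1 * h ^+ n) -> P (g^-1 * h)) ->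
  (forall A, is_normal A -> (forall x, A x -> ~ P x) ->
     forall g h, P g -> A h -> P (g * h)) ->
  (forall g h, P g -> exists i : int, ~ P ((zpow g i)^-1 * h)) ->
  nontrivial_full_archimedean (fun g h : G => P (g^-1 * h)).
Proof.
move=> P1 PM PJ [p Pp] Pprim Pfac Parch.
have ltO : is_order (fun g h : G => P (g^-1 * h)).
  split=> [g|g h gh hg|f g h fg gh|f g h|f g h /(PJ _ h)].
  - by rewrite mulVg.
  - by apply: P1; have := PM _ _ gh hg; rewrite -mulgA mulVKg mulVg.
  - by have := PM _ _ fg gh; rewrite -mulgA mulVKg.
  - by rewrite invgM -mulgA mulKg.
  - by rewrite invgM /conjg !mulgA.
split=> //.
- by move=> /(_ 1 p); rewrite invg1 mul1g.
- split=> [g h [|n] /=|]; last first.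
    apply/(factorizingP ltO) => A hA nA u Au g; rewrite !invg1 !mul1g.
    have [[_ _ AV] _] := hA.
    have nA' x : A x -> ~ P x by move=> /nA; rewrite invg1 mul1g.
    split=> [Pgu|Pg]; last exact: Pfac Pg Au.
    by rewrite -(mulgK u g); apply: (Pfac _ hA nA' _ _ Pgu); exact: AV.
  + exact: Pprim.
  + by rewrite !expg0 invg1 mul1g.
- move=> [g [h [Pg gh]]]; rewrite /positive invg1 mul1g in Pg.
  by have [i] := Parch g h Pg; apply; exact: gh.
Qed.

Section Dot.
Local Open Scope ring_scope.
Variable n : nat.
Implicit Types x f g : 'rV[int]_n.

Definition dot x f : int := \sum_i x 0 i * f 0 i.
Definition norm1 x : int := \sum_i `|x 0 i|.

Lemma dotDr x f g : dot x (f + g) = dot x f + dot x g.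
Proof. by rewrite -big_split; apply: eq_bigr => i _; rewrite mxE mulrDr. Qed.

Lemma dotC x f : dot x f = dot f x.
Proof. by apply: eq_bigr => i _; rewrite mulrC. Qed.

Lemma dotZr (c : int) x f : dot x (c *: f) = c * dot x f.
Proof. by rewrite mulr_sumr; apply: eq_bigr => i _; rewrite mxE mulrCA. Qed.

Lemma dotNr x f : dot x (- f) = - dot x f.
Proof. by rewrite -scaleN1r dotZr mulN1r. Qed.

Lemma dot_delta x i : dot x (delta_mx 0 i) = x 0 i.
Proof.
rewrite /dot (bigD1 i) //= big1 => [|j ji]; rewrite mxE eqxx ?(negbTE ji) ?mulr0 //.
by rewrite eqxx mulr1 addr0.
Qed.

Lemma norm1_ge0 x : 0 <= norm1 x.
Proof. exact: sumr_ge0. Qed.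

Lemma ler_norm1 x i : `|x 0 i| <= norm1 x.
Proof. by rewrite /norm1 (bigD1 i) //= lerDl sumr_ge0. Qed.

Lemma dot_le x f : `|dot x f| <= norm1 x * norm1 f.
Proof.
rewrite /norm1 mulr_sumr; apply: le_trans (ler_norm_sum _ _ _) _.
apply: ler_sum => i _; rewrite normrM; apply: ler_wpM2r => //; exact: ler_norm1.
Qed.

Lemma dotxx_ge0 x : 0 <= dot x x.
Proof. by apply: sumr_ge0 => i _; rewrite -expr2 sqr_ge0. Qed.

Lemma dotxxD x f : dot (x + f) (x + f) = dot x x + 2 * dot x f + dot f f.
Proof.
rewrite dotDr dotC dotDr (dotC (x + f)) dotDr (dotC f x).
lia.
Qed.

Lemma norm1_large x (R : nat) : (R * R)%:Z < dot x x -> R%:Z < norm1 x.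
Proof.
move=> RR; rewrite ltNge; apply/negP => xR.
have := le_trans (ler_norm _) (dot_le x x).
move=> h; have := norm1_ge0 x; nia.
Qed.
End Dot.

Section Direction.
Local Open Scope ring_scope.
Variables (n : nat) (U : set_system 'rV[int]_n).
Hypothesis (UU : UltraFilter U).
Hypothesis Uinf : forall R : nat, U [set x | R%:Z < norm1 x].
Implicit Types x f g : 'rV[int]_n.

(** The vectors [x] run through [U] to infinity; [inward f] says that along [U]
    the angle of [f] with [- x] stays bounded away from a right angle. Up to a
    scalar, [f |-> - dot x f / norm1 x] tends along [U] to a linear form, and
    [inward f] means that the limit is positive. *)
Definition inward f : Prop :=
  exists k : nat, U [set x | norm1 x <= - (k%:Z * dot x f)].

Lemma not_inward f (k : nat) : ~ inward f -> U [set x | - (k%:Z * dot x f) < norm1 x].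
Proof.
move=> nf; have [Uf|] := in_ultra_setVsetC [set x | norm1 x <= - (k%:Z * dot x f)] UU.
  by case: nf; exists k.
by apply: filterS => x /= /negP; rewrite -ltNge.
Qed.

Lemma ultra_nonempty (F : set 'rV[int]_n) : U F -> exists x, F x.
Proof. exact: filter_ex. Qed.

(** A vector whose opposite is not inward has nonnegative limit, so adding it
    keeps the limit positive. *)
Lemma inwardD f g : inward f -> ~ inward (- g) -> inward (f + g).
Proof.
move=> [k Uk] /(not_inward (2 * k)) Ug; exists (2 * k)%N.
apply: filterS (filterI Uk Ug) => x /= [kx gx].
rewrite dotDr; rewrite dotNr PoszM -mulrA mulrN mulrN opprK in gx.
rewrite PoszM -mulrA mulrDr; lia.
Qed.

Lemma inward_asym f : inward f -> ~ inward (- f).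
Proof.
move=> [k Uk] [k' Uk'].
have [x /= [[kx kx'] x0]] := ultra_nonempty (filterI (filterI Uk Uk') (Uinf 0)).
rewrite dotNr mulrN opprK in kx'; move: kx kx' x0.
move: (norm1 x) (dot x f) => D a kx kx' x0.
have : a < 0 by nia.
have : 0 < a by nia.
lia.
Qed.

Lemma inward0 : ~ inward 0.
Proof. by move=> i0; apply: (inward_asym i0); rewrite oppr0. Qed.

Lemma inwardMn f m : inward (f *+ m) -> inward f.
Proof.
move=> [k Uk]; exists (k * m)%N; apply: filterS Uk => x /=.
rewrite -scaler_nat dotZr; rewrite natz PoszM; lia.
Qed.

(** The multiple exceeds the ratio of the limits of [g] and [f]. *)
Lemma inward_arch f g : inward f -> exists m : nat, ~ inward (g - f *+ m).
Proof.
move=> [k Uk]; exists (k * `|norm1 g|)%N => -[k' Uk'].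
have [x /= [[kx kx'] x0]] := ultra_nonempty (filterI (filterI Uk Uk') (Uinf 0)).
have := dot_le x g; rewrite dotDr dotNr -scaler_nat dotZr natz PoszM in kx' *.
rewrite gez0_abs ?norm1_ge0 //= in kx' *.
set D := norm1 x in kx kx' x0 *; set a := dot x f in kx kx' *.
set b := dot x g in kx' *; set N := norm1 g in kx' *.
have N0 : 0 <= N := norm1_ge0 g; have k0 : (0 <= k%:Z) by [].
have k'0 : (0 <= k'%:Z) by []; rewrite ler_norml => /andP[Db _].
have pos : 0 < k'%:Z * (k%:Z * N * a - b) by lia.
have pos' : 0 < k%:Z * N * a - b by nia.
have : k%:Z * b < k%:Z * (k%:Z * N * a) by nia.
have : k%:Z * N * (k%:Z * a) <= - (k%:Z * N * D) by nia.
have : - (k%:Z * (D * N)) <= k%:Z * b by nia.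
nia.
Qed.

(** The squared norm changes by [2 * dot x f + dot f f], where the first term is
    at most a negative multiple of [norm1 x], which tends to infinity. *)
Lemma inward_gain f : inward f -> U [set x | dot (x + f) (x + f) < dot x x].
Proof.
move=> [k Uk].
apply: filterS (filterI (filterI Uk (Uinf 0)) (Uinf (k * `|dot f f|))) => x /= [[kx x0]].
rewrite PoszM gez0_abs ?dotxx_ge0 // dotxxD.
have := dotxx_ge0 f; move: (dot f f) (dot x f) (norm1 x) kx x0 (dot x x).
move=> q a D kx x0 X q0 kq.
have : q < - a by nia.
lia.
Qed.

(** If no coordinate vector were inward up to sign, all coordinates of [x] would
    be negligible with respect to [norm1 x], their sum. *)
Lemma inward_nontrivial (L : set 'rV[int]_n) : U L ->
  (forall i, (exists c, [/\ 0 < c, L (c *: delta_mx 0 i) & L (- (c *: delta_mx 0 i))]) \/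
             (forall x, L x -> x 0 i = 0)) ->
  exists2 f, L f & inward f.
Proof.
move=> UL Li; apply: contrapT => nL.
have nLf f : L f -> ~ inward f by move=> Lf inf; apply: nL; exists f.
(* With [n] coordinates, each below [norm1 x / n], the sum falls short. *)
have small i : U [set x : 'rV[int]_n | n%:Z * `|x 0 i| < norm1 x].
  case: (Li i) => [[c [c0 Lc LcN]]|Lx0]; last first.
    apply: filterS (filterI UL (Uinf 0)) => x /= [/Lx0 -> x0].
    by rewrite normr0 mulr0.
  apply: filterS (filterI (not_inward n (nLf _ Lc)) (not_inward n (nLf _ LcN))) => x /=.
  rewrite dotNr dotZr dot_delta; move: (norm1 x) (x 0 i) => D a [h1 h2].
  have : n%:Z * (c * `|a|) < D by case: (ger0P a) => _; rewrite -?mulrN in h1 h2 *; lia.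
  apply: le_lt_trans; rewrite ler_wpM2l //; have := normr_ge0 a; nia.
have all_small (s : seq 'I_n) :
    U [set x : 'rV[int]_n | forall i, i \in s -> n%:Z * `|x 0 i| < norm1 x].
  elim: s => [|i s IH]; first by apply: filterS (filterT (F := U)) => x _ j.
  apply: filterS (filterI (small i) IH) => x [hi hs] j.
  by rewrite in_cons => /orP[/eqP->|/hs].
have [x [hx x0]] := ultra_nonempty (filterI (all_small (enum 'I_n)) (Uinf 0)).
have n0 : (0 < n)%N.
  case: (posnP n) => // n0; move: x0; rewrite /= /norm1 big1 // => i.
  by move: (ltn_ord i); rewrite {2}n0.
have : \sum_(i < n) n%:Z * `|x 0 i| < \sum_(i < n) norm1 x.
  apply: ltr_sum => [|i _]; last by apply: hx; rewrite mem_enum.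
  by apply/hasP; exists (Ordinal n0) => //; rewrite mem_index_enum.
by rewrite sumr_const card_ord -mulr_sumr -/(norm1 x) -mulr_natl natz ltxx.
Qed.

End Direction.

Section DirectionOrder.
Variables (G : groupType) (n : nat) (lam : G -> 'rV[int]_n) (U : set_system 'rV[int]_n).
Hypothesis lamM : forall x y, lam (x * y) = (lam x + lam y)%R.
Hypothesis lam_delta : forall i,
  (exists g c, (0 < c)%R /\ lam g = (c *: delta_mx 0 i)%R) \/ (forall g, lam g 0%R i = 0%R).
Hypothesis (UU : UltraFilter U).
Hypothesis Uinf : forall R : nat, U [set x | (R%:R < norm1 x)%R].
Hypothesis Ulam : U (range lam).

Lemma lam1 : lam 1 = 0%R.
Proof. by apply: (addrI (lam 1)); rewrite -lamM mulg1 addr0. Qed.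

Lemma lamV x : lam x^-1 = (- lam x)%R.
Proof. by apply: (addrI (lam x)); rewrite -lamM mulgV lam1 subrr. Qed.

Lemma lamX x m : lam (x ^+ m) = (lam x *+ m)%R.
Proof.
elim: m => [|m IH]; first by rewrite expg0 lam1.
by rewrite expgS lamM IH mulrS.
Qed.

Lemma lamJ x g : lam (x ^ g) = lam x.
Proof. by rewrite /conjg !lamM lamV addrC addrK. Qed.

Definition direction_order : relation G := fun g h => inward U (lam (g^-1 * h)).

Let Uinf' R : U [set x | (R%:Z < norm1 x)%R].
Proof. by rewrite -natz; exact: Uinf. Qed.

(** The order is the pull-back of the usual order of the reals along the limit
    linear form of [inward]. *)
Lemma direction_order_nfa : nontrivial_full_archimedean direction_order.
Proof.
apply: (@cone_order_nfa G [set g | inward U (lam g)]) => /=.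
- by rewrite lam1; exact: inward0.
- move=> x y ix iy; rewrite lamM; apply: inwardD => //; exact: inward_asym.
- by move=> x g; rewrite lamJ.
- have [|f [g _ <-] ig] := inward_nontrivial UU Uinf' Ulam; last by exists g.
  move=> i; case: (lam_delta i) => [[g [c [c0 gE]]]|h]; [left|right].
    by exists c; split=> //; [exists g|exists g^-1 => //; rewrite lamV gE].
  by move=> _ [g _ <-].
- move=> g h m m0; rewrite !lamM !lamV !lamX -mulNrn -mulrnDl; exact: inwardMn.
- move=> A hA nA g h ig Ah; rewrite lamM; apply: inwardD => //.
  by rewrite -lamV; apply: nA; case: hA => -[_ _ AV] _; exact: AV.
- move=> g h ig; have [m hm] := inward_arch UU Uinf' (lam h) ig; exists (Posz m).
  by rewrite /= lamM lamV lamX addrC.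
Qed.

Lemma direction_order1 g : direction_order 1 g <-> inward U (lam g).
Proof. by rewrite /direction_order invg1 mul1g. Qed.

End DirectionOrder.

(** * Pulling paths towards the kernel *)

Section Push.
Variables (G : groupType) (n : nat) (lam : G -> 'rV[int]_n) (S : seq G).
Hypothesis lamM : forall x y, lam (x * y) = (lam x + lam y)%R.
Hypothesis lam_delta : forall i,
  (exists g c, (0 < c)%R /\ lam g = (c *: delta_mx 0 i)%R) \/ (forall g, lam g 0%R i = 0%R).
Hypothesis orders : forall lt : relation G, nontrivial_full_archimedean lt ->
  (forall x, lam x = 0%R -> ~ lt 1 x) -> coarsely_connected (half_space lt).
Hypothesis genS : generated [set` S] = [set: G].
Hypothesis symS : forall s, s \in S -> s^-1 \in S.

Lemma cayley_ind (P : set G) : P 1 -> (forall g s, P g -> s \in S -> P (g * s)) ->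
  forall g, P g.
Proof.
move=> P1 PS.
have [g1 gM gV] := generated_subgroup [set` S].
suff H h : generated [set` S] h -> forall g, P g -> P (g * h) /\ P (g * h^-1).
  by move=> g; have [] := H g _ 1 P1; rewrite ?genS // mul1g.
move: h; apply: (@generated_min _ _ [set h | forall g, P g -> P (g * h) /\ P (g * h^-1)]).
  split=> [g Pg|x y hx hy g Pg|x hx g Pg] /=; first by rewrite invg1 mulg1.
    rewrite invgM !mulgA; split.
      by apply: (hy _ _).1; apply: (hx _ _).1.
    by apply: (hx _ _).2; apply: (hy _ _).2.
  by rewrite invgK; split; [apply: (hx _ _).2|apply: (hx _ _).1].
by move=> s /= sS g Pg; split; apply: PS => //; exact: symS.
Qed.

Definition qnorm g : int := dot (lam g) (lam g).
Definition below (M : int) : set G := [set g | (qnorm g < M)%R].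

Let lam1 := lam1 lamM.
Let lamV := lamV lamM.
Let lamX := lamX lamM.
Let lamJ := lamJ lamM.

(** What allows a path through [v * s], [v] and [v * s'] to avoid [v]: both
    neighbours first move along the same generator [t], and from there on only
    vertices of smaller norm are visited. *)
Definition pushable v s s' : Prop := exists t, [/\ t \in S,
  (qnorm (v * s * t) < qnorm v)%R, (qnorm (v * s' * t) < qnorm v)%R &
  linked S (below (qnorm v)) (v * s * t) (v * s' * t)].

Section Limit.
Variable U : set_system 'rV[int]_n.
Hypothesis (UU : UltraFilter U).
Hypothesis Uinf : forall R : nat, U [set x : 'rV[int]_n | (R%:R < norm1 x)%R].
Hypothesis Ulam : U (range lam).

Let P g := inward U (lam g).
Let lt := direction_order lam U.
Let W := half_space lt.

Let Uinf' R : U [set x : 'rV[int]_n | (Posz R < norm1 x)%R].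
Proof. by rewrite -natz; exact: Uinf. Qed.

Let nfa : nontrivial_full_archimedean lt.
Proof. exact: direction_order_nfa. Qed.

Let ltO : is_order lt. Proof. by case: nfa. Qed.

Let lt1 g : lt 1 g <-> P g. Proof. exact: direction_order1. Qed.

Lemma half_space_direction g : ~ P g^-1 -> W g.
Proof.
move=> nPg; have [_ _ [prim fac] _] := nfa.
have cg : central_mod (isotropy lt) g.
  move=> x h; rewrite !lt1 /P lamM.
  by have -> : lam [~ g, x] = 0%R; rewrite ?addr0 // /commg lamM lamJ lamV addNr.
case: (central_comparable ltO prim fac cg) => [Ig|Pg|/lt1//]; first by left.
by right.
Qed.

Lemma direction_half_space u g : P u -> W g -> P (u * g).
Proof.
by move=> /lt1 Pu [Ig|Pg]; apply/lt1; [apply/Ig|exact: coneM].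
Qed.

Lemma inward_generator : exists2 t, t \in S & P t.
Proof.
apply: contrapT => nP; have [_ ntriv _ _] := nfa; apply: ntriv => g h.
have [[I1 IM IV] _] := isotropy_normal ltO.
have SI s : s \in S -> isotropy lt s.
  move=> sS; have [|Is|/lt1 Ps] := @half_space_direction s; [|by []|].
    by move=> Ps; apply: nP; exists s^-1 => //; exact: symS.
  by case: nP; exists s.
have GI x : isotropy lt x.
  by move: x; apply: cayley_ind => // x s Ix /SI; exact: IM.
move=> gh; exact: (isotropy_antichain ltO (GI g) (GI h)).
Qed.

(** If [s] were outside the half-space, its inverse would be inward and [s] would
    lead away from the origin. *)
Lemma half_space_of_edge s :
  U [set x | exists2 v, lam v = x & (qnorm (v * s) <= qnorm v)%R] -> W s.
Proof.
move=> Us; apply: half_space_direction => -[k Uk].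
have [_ /= [[[v <-] +]]] := ultra_nonempty UU (filterI (filterI Us Uk) (Uinf' 0)).
rewrite /qnorm lamM dotxxD lamV dotNr mulrN opprK => h1 h2 h3.
have := dotxx_ge0 (lam s).
move: (dot (lam s) _) (dot (lam v) (lam s)) (dot (lam v) (lam v)) (norm1 _) h1 h2 h3.
move=> a b c d h1 h2 h3 h4; have : (0 < b)%R by nia.
lia.
Qed.

Lemma inward_power t g : P t -> exists k0, forall k, (k0 <= k)%N -> P (t ^+ k * g).
Proof.
move=> Pt; have [m hm] := inward_arch UU Uinf' (- lam g)%R Pt.
have Wm : W (t ^+ m * g).
  apply: half_space_direction; rewrite /P lamV lamM lamX opprD addrC; exact: hm.
exists m.+1 => k mk; rewrite -(subnK (ltnW mk)) expgnDr -mulgA.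
apply: direction_half_space => //; rewrite -(subnSK mk).
by apply/lt1; apply: coneX => //; apply/lt1.
Qed.

Lemma inward_congr g h : lam g = lam h -> P g -> P h.
Proof. by rewrite /P => ->. Qed.

(** Each of the finitely many vertices of a path within the positive cone brings
    [v] closer to the origin, for almost all [v]. *)
Lemma linked_inward t : P t -> forall y z, linked S P y z ->
  U [set x | forall v, lam v = x -> linked S (below (qnorm v)) (v * y) (v * z)].
Proof.
move=> Pt y z; have gain g : P g ->
    U [set x | forall v, lam v = x -> (qnorm (v * g) < qnorm v)%R].
  by move=> /(inward_gain UU Uinf'); apply: filterS => x /= gx v vx; rewrite /qnorm lamM vx.
elim=> [{}y {}z [Py Pz [s sS yz]]|{}y|{}y {}z w _ yz _ zw].
- apply: filterS (filterI (gain _ Py) (gain _ Pz)) => x /= [gy gz] v vx.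
  apply: rt_step; split; [exact: gy|exact: gz|].
  by exists s => //; case: yz => ->; rewrite mulgA; [left|right].
- by apply: filterS (filterT (F := U)) => x _ v _; exact: linked_refl.
- apply: filterS (filterI yz zw) => x /= [hy hz] v vx.
  by apply: linked_trans (hz v vx); exact: hy.
Qed.

(** The elements [s] and [s'] lie in the half-space of the limit order. Choose a
    positive generator [t]. Multiplying by powers of [t] on the right moves [s]
    and [s'] deep into the positive cone, where they are joined by a translate
    by [t ^+ k] of a path in the half-space. The path given by coarse
    connectivity uses other generators than [S]; replacing them by words in [S]
    strays from the half-space by a bounded amount, for which [k] makes up. The
    resulting path is positive, so [linked_inward] contradicts the choice of
    [U]. *)
Lemma pushable_limit s s' : s \in S -> s' \in S ->
  U [set x | exists v, [/\ lam v = x, (qnorm (v * s) <= qnorm v)%R,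
                            (qnorm (v * s') <= qnorm v)%R & ~ pushable v s s']] -> False.
Proof.
move=> sS s'S Ubad.
have Ws : W s.
  by apply: half_space_of_edge; apply: filterS Ubad => x [v [vx ? ? ?]]; exists v.
have Ws' : W s'.
  by apply: half_space_of_edge; apply: filterS Ubad => x [v [vx ? ? ?]]; exists v.
have [t tS Pt] := inward_generator.
have Wlam g h : lam g = lam h -> W g -> W h.
  move=> gh Wg; apply: half_space_direction; rewrite /P lamV -gh -lamV => Pg.
  have := direction_half_space Pg Wg; rewrite mulVg.
  by move/lt1; exact: (cone1 ltO).
have [l [_ con]] : exists l, W `<=` generated [set` l] /\
    forall x y, W x -> W y -> linked l W x y.
  apply: coarsely_connected_elim; apply: orders => // x x0 /lt1.
  by rewrite /P x0; exact: (inward0 UU Uinf').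
pose Q tau k := forall w, W w -> P (t ^+ k * w * tau) /\
  linked S P (t ^+ k * w) (t ^+ k * w * tau).
(* A word [tau] stays within the positive cone once started high enough
   above the half-space. *)
have c1 tau : exists k0, forall k, (k0 <= k)%N -> Q tau k.
  move: tau; apply: cayley_ind => [|tau r [k0 k0P] rS].
    exists 1%N => k k1 w Ww; rewrite mulg1; split; last exact: linked_refl.
    apply: direction_half_space => //; rewrite -(prednK k1).
    by apply/lt1; apply: coneX => //; apply/lt1.
  have [k1 k1P] := inward_power (tau * r) Pt.
  exists (maxn k0 k1) => k; rewrite geq_max => /andP[kk0 kk1] w Ww.
  have [Ptw lk] := k0P k kk0 w Ww; rewrite mulgA.
  have Ptwr : P (t ^+ k * w * tau * r).
    apply: (inward_congr _ (direction_half_space (k1P k kk1) Ww)).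
    by rewrite !lamM !addrA (addrAC _ (lam w) (lam tau)) (addrAC _ (lam w) (lam r)).
  by split=> //; apply: linked_trans lk _; exact: linked_step.
have [k0 k0P] : exists k0, forall k, (k0 <= k)%N -> forall tau, tau \in l -> Q tau k.
  elim: (l) => [|tau l' [k0 k0P]]; first by exists 0%N.
  have [k1 k1P] := c1 tau; exists (maxn k0 k1) => k.
  rewrite geq_max => /andP[kk0 kk1] tau'; rewrite in_cons.
  move=> /orP[/eqP->|]; first exact: k1P.
  exact: k0P.
have c3 x y : linked l W x y ->
    forall k, (k0 <= k)%N -> linked S P (t ^+ k * x) (t ^+ k * y).
  elim=> [{}x {}y [Wx Wy [tau taul [->|->]]]|{}x|{}x {}y z _ h1 _ h2] k kk0.
  - by rewrite mulgA; have [] := k0P k kk0 tau taul _ Wx.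
  - by rewrite mulgA; apply: linked_sym; have [] := k0P k kk0 tau taul _ Wy.
  - exact: linked_refl.
  - exact: linked_trans (h1 _ kk0) (h2 _ kk0).
have Pst r k : W r -> P (r * t ^+ k.+1).
  move=> Wr; have Ptk : P (t ^+ k.+1) by apply/lt1; apply: coneX => //; apply/lt1.
  by apply: (inward_congr _ (direction_half_space Ptk Wr)); rewrite !lamM addrC.
have c4 r k : W r -> linked S P (r * t) (r * t ^+ k.+1).
  move=> Wr; elim: k => [|k IH]; first by rewrite expg1; exact: linked_refl.
  apply: linked_trans IH _; rewrite (expgSr _ k.+1) mulgA.
  apply: linked_step => //; first exact: Pst.
  by rewrite -mulgA -expgSr; exact: Pst.
have Wc r k : W r -> W ((t ^+ k)^-1 * (r * t ^+ k)).
  by move=> Wr; apply: (Wlam r) => //; exact/esym/lamJ.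
have path : linked S P (s * t) (s' * t).
  apply: linked_trans (c4 s k0 Ws) _; apply: linked_trans (linked_sym (c4 s' k0 Ws')).
  have := c3 _ _ (con _ _ (Wc s k0.+1 Ws) (Wc s' k0.+1 Ws')) k0.+1 (leqnSn _).
  by rewrite !mulVKg.
have gain g : P g -> U [set x | forall v, lam v = x -> (qnorm (v * g) < qnorm v)%R].
  by move=> /(inward_gain UU Uinf'); apply: filterS => x /= gx v vx; rewrite /qnorm lamM vx.
have Pt1 r : W r -> P (r * t) by move=> /(Pst _ 0%N); rewrite expg1.
have [_ /= [[[v [<- _ _ nv]] lk] [g1 g2]]] := ultra_nonempty UU (filterI
  (filterI Ubad (linked_inward Pt path))
  (filterI (gain _ (Pt1 s Ws)) (gain _ (Pt1 s' Ws')))).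
apply: nv; exists t; rewrite -!mulgA; split=> //; [exact: g1|exact: g2|exact: lk].
Qed.

End Limit.

(** Otherwise the bad vertices of large norm generate a proper filter, and any
    ultrafilter containing it contradicts [pushable_limit]. *)
Lemma pushable_far s s' : s \in S -> s' \in S -> exists R : nat, forall v,
  (R%:R < qnorm v)%R -> (qnorm (v * s) <= qnorm v)%R -> (qnorm (v * s') <= qnorm v)%R ->
  pushable v s s'.
Proof.
move=> sS s'S; apply: contrapT => /forallNP nR.
pose bad (R : nat) := [set x | exists v, [/\ lam v = x, (R%:R < qnorm v)%R,
  (qnorm (v * s) <= qnorm v)%R, (qnorm (v * s') <= qnorm v)%R & ~ pushable v s s']].
have badS R R' : (R <= R')%N -> bad R' `<=` bad R.
  move=> RR' x [v [vx Rv ? ? ?]]; exists v; split=> //.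
  by apply: le_lt_trans Rv; rewrite ler_nat.
pose F : set_system 'rV[int]_n := [set A | exists R, bad R `<=` A].
have FF : ProperFilter F.
  constructor.
    move=> [R bR]; apply: (nR R) => v Rv vs vs'; apply: contrapT => nv.
    by apply: (bR (lam v)); exists v.
  constructor; first by exists 0%N.
    move=> A B [R RA] [R' RB]; exists (maxn R R') => x bx; split.
      by apply: RA; apply: badS bx; rewrite leq_maxl.
    by apply: RB; apply: badS bx; rewrite leq_maxr.
  by move=> A B AB [R RA]; exists R => x /RA/AB.
have [U [UU FU]] := ultraFilterLemma FF.
apply: (@pushable_limit U UU _ _ s s' sS s'S).
- move=> R; apply: FU; exists (R * R)%N => x [v [<- Rv _ _ _]] /=.
  by rewrite natz; apply: norm1_large; move: Rv; rewrite natz.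
- by apply: FU; exists 0%N => x [v [<- _ _ _ _]]; exists v.
- by apply: FU; exists 0%N => x [v [vx _ ? ? ?]]; exists v.
Qed.

Definition at_most (M : nat) : set G := [set g | (qnorm g <= M%:R)%R].

Lemma pushable_far_all : exists R : nat, forall s s' v, s \in S -> s' \in S ->
  (R%:R < qnorm v)%R -> (qnorm (v * s) <= qnorm v)%R -> (qnorm (v * s') <= qnorm v)%R ->
  pushable v s s'.
Proof.
have maxR (T : eqType) (l : seq T) (Q : T -> nat -> Prop) :
    (forall x R R', (R <= R')%N -> Q x R -> Q x R') ->
    {in l, forall x, exists R, Q x R} -> exists R, {in l, forall x, Q x R}.
  move=> mono; elim: l => [|x l IH] lQ; first by exists 0%N.
  have [|R RP] := IH; first by move=> y yl; apply: lQ; rewrite in_cons yl orbT.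
  have [R' RP'] := lQ x (mem_head _ _); exists (maxn R R') => y.
  rewrite in_cons => /orP[/eqP->|yl]; first by apply: mono RP'; exact: leq_maxr.
  by apply: mono (RP y yl); exact: leq_maxl.
have [||R RP] := @maxR _ [seq (s, s') | s <- S, s' <- S] (fun ss R => forall v,
  (R%:R < qnorm v)%R -> (qnorm (v * ss.1) <= qnorm v)%R ->
  (qnorm (v * ss.2) <= qnorm v)%R -> pushable v ss.1 ss.2).
- by move=> x R R' RR' h v Rv; apply: h; apply: le_lt_trans Rv; rewrite ler_nat.
- by move=> _ /allpairsP[[s s'] [/= sS s'S ->]]; exact: pushable_far.
exists R => s s' v sS s'S; apply: (RP (s, s')).
by apply/allpairsP; exists (s, s').
Qed.

(** Follow the path from [x]. While it stays on vertices of norm [M], carry along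
    a neighbour of the current vertex of smaller norm that is already linked to
    [x]; [pushable] at the current vertex carries it to the next one. *)
Lemma linked_descent (R M : nat) x y :
  (forall s s' v, s \in S -> s' \in S ->
    (R%:R < qnorm v)%R -> (qnorm (v * s) <= qnorm v)%R -> (qnorm (v * s') <= qnorm v)%R ->
    pushable v s s') ->
  (R < M)%N -> linked S (at_most M) x y -> below M%:R%R x -> below M%:R%R y ->
  linked S (below M%:R%R) x y.
Proof.
move=> push RM lxy xM; have {lxy} xy := clos_rt_rtn1 _ _ _ _ lxy.
suff [] : (below M%:R%R y -> linked S (below M%:R%R) x y) /\
    (qnorm y = M%:R%R -> exists s, [/\ s \in S, below M%:R%R (y * s) &
      linked S (below M%:R%R) x (y * s)]) by [].
elim: xy => [|{}y z yz _ [IH1 IH2]].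
  by split=> [_|xE]; [exact: linked_refl|move: xM; rewrite /below /= xE ltxx].
have {yz}[yM zM [s sS zE]] : [/\ at_most M y, at_most M z & exists2 s, s \in S & z = y * s].
  case: yz => yM zM [s sS yzE]; split=> //; case: yzE => yzE; first by exists s.
  by exists s^-1; [exact: symS|rewrite yzE mulgK].
rewrite zE in zM *.
move: yM; rewrite /at_most /= le_eqVlt => /orP[/eqP yE|yM]; last first.
  have xy := IH1 yM; split=> [ysM|ysE].
    by apply: linked_trans xy _; exact: linked_step.
  by exists s^-1; rewrite mulgK; split=> //; exact: symS.
have [s0 [s0S ys0M xys0]] := IH2 yE.
have [|||t [tS t1 t2 lk]] := push s0 s y s0S sS.
- by rewrite yE ltr_nat.
- by rewrite yE; exact: ltW.
- by rewrite yE.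
rewrite yE in t1 t2 lk.
have xyst : linked S (below M%:R%R) x (y * s * t).
  apply: linked_trans xys0 _; apply: linked_trans lk.
  exact: linked_step.
split=> [ysM|_]; last by exists t.
by apply: linked_trans xyst _; apply: linked_sym; exact: linked_step.
Qed.

Lemma kernel_linked_bounded : exists R, forall x, lam x = 0%R -> linked S (at_most R) 1 x.
Proof.
have [R push] := pushable_far_all; exists R => x x0.
have x0q : qnorm x = 0%R.
  by rewrite /qnorm x0 /dot big1 // => i _; rewrite !mxE mul0r.
have q1 : qnorm 1 = 0%R by rewrite /qnorm lam1 /dot big1 // => i _; rewrite !mxE mul0r.
have [M] : exists M, linked S (at_most M) 1 x.
  suff [M] : exists M, at_most M x /\ linked S (at_most M) 1 x by move=> []; exists M.
  have qM g : exists M, at_most M g.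
    exists (absz (qnorm g)); rewrite /at_most /= natz gez0_abs //; exact: dotxx_ge0.
  have mono M M' : (M <= M')%N -> at_most M `<=` at_most M'.
    by move=> MM' g /le_trans; apply; rewrite ler_nat.
  move: x {x0 x0q}; apply: cayley_ind => [|g s [M [gM lM]] sS].
    by have [M M1] := qM 1; exists M; split=> //; exact: linked_refl.
  have [M' M'gs] := qM (g * s); exists (maxn M M').
  have sub := mono _ _ (leq_maxl M M'); have sub' := mono _ _ (leq_maxr M M').
  split; first exact: sub'.
  apply: linked_trans (linked_sub sub lM) _.
  by apply: linked_step => //; [exact: sub|exact: sub'].
elim: M => [|M IH] lM.
  by apply: linked_sub lM => g /le_trans; apply; rewrite ler_nat.
have [RM|MR] := ltnP R M.+1; last first.
  by apply: linked_sub lM => g /le_trans; apply; rewrite ler_nat.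
apply: IH; have := linked_descent push RM lM.
rewrite /below /= q1 x0q ltr0n => /(_ isT isT); apply: linked_sub => g /=.
by rewrite /at_most /= natz natz; lia.
Qed.

(** The kernel is connected inside a region of bounded norm, which meets only
    finitely many cosets of it, so [schreier] applies. *)
Lemma kernel_finitely_generated : finitely_generated [set x | lam x = 0%R].
Proof.
have [R con] := kernel_linked_bounded.
have /choice[rho rhoP] : forall x : 'rV[int]_n, exists g,
    (exists h, lam h = x) -> lam g = x.
  move=> x; have [[h hx]|nh] := pselect (exists h, lam h = x); first by exists h.
  by exists 1 => h; case: nh.
(* The square of an entry of [lam g] is at most [qnorm g], so on the region
   in question the entries are at most [R] in absolute value. *)
pose vec (f : {ffun 'I_n -> 'I_(2 * R).+1}) : 'rV[int]_n :=
  (\row_i ((f i)%:Z - R%:Z))%R.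
apply: (@schreier _ _ S (at_most R)
  [seq rho (vec f) | f <- enum {ffun 'I_n -> 'I_(2 * R).+1}]).
- split=> [|x y x0 y0|x x0] /=; first exact: lam1.
    by rewrite lamM x0 y0 addr0.
  by rewrite lamV x0 oppr0.
- move=> g gR.
  have bnd i : (`|lam g 0 i| <= R%:Z)%R.
    have h : (lam g 0 i * lam g 0 i <= R%:Z)%R.
      apply: le_trans (_ : qnorm g <= _)%R; last by move: gR; rewrite /at_most /= natz.
      rewrite /qnorm /dot (bigD1 i) //= lerDl; apply: sumr_ge0 => j _.
      by rewrite -expr2 sqr_ge0.
    by move: (lam g 0%R i) h => z h; nia.
  pose f : {ffun 'I_n -> 'I_(2 * R).+1} := [ffun i => inord (absz (lam g 0 i + R%:Z)%R)].
  have fE : vec f = lam g.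
    apply/rowP => i; rewrite !mxE ffunE; have := bnd i.
    move: (lam g 0%R i) => z hz; rewrite inordK; lia.
  exists (rho (vec f)); first by apply: map_f; rewrite mem_enum.
  by rewrite /= lamM lamV fE (rhoP (lam g)) ?subrr //; exists g.
- exact: con.
Qed.

End Push.

(** In a maximal counterexample [M] the quotient is torsion-free, because an
    element of finite order would generate a finite extension of [M], to which
    [finitely_generated_cyclic_ext] applies. So [M] is the whole kernel of the
    coordinates. *)
Lemma finitely_generated_of_orders (G : groupType) (N : set G) :
  is_normal N -> (forall x y, N [~ x, y]) -> finitely_generated [set: G] ->
  (forall lt : relation G, nontrivial_full_archimedean lt -> antichain lt N ->
     coarsely_connected (half_space lt)) ->
  finitely_generated N.
Proof.
move=> hN abN fG orders; apply: contrapT => nN.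
have [M [hM NM nM maxM]] := maximal_not_fg hN nN.
have abM x y : M [~ x, y] by exact: NM.
have [l lE] := (fgP _).1 fG.
have fM : fg_mod M [set: G].
  exists l; apply/seteqP; split=> // x _.
  by move: (I : setT x); rewrite -lE; apply: generatedS; right.
have [n [lam [lamM lam0 lamT lam_delta]]] := coordinates hM abM fM.
have ME : M = [set x | lam x = 0%R].
  apply/seteqP; split=> [x /lam0//|x /lamT[e e0 Mxe]].
  apply: contrapT => nMx; apply: nM.
  apply: (finitely_generated_cyclic_ext hM _ e0 Mxe); first by move=> y.
  apply: maxM; [by apply: cyclic_ext_normal => // y|exact: sub_cyclic_ext|].
  by move=> sub; apply: nMx; apply: sub; apply: cyclic_ext_gen; case: hM => -[].
apply: nM; rewrite ME.
apply: (@kernel_finitely_generated _ _ _ (l ++ [seq s^-1 | s <- l]) lamM lam_delta).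
- move=> lt nfa nlt; apply: orders => //; have [ltO _ _ _] := nfa.
  by apply/(antichainP ltO hN.1) => x /NM/lam0; exact: nlt.
- apply/seteqP; split=> // x _; have : generated [set` l] x by rewrite lE.
  by apply: generatedS => y /= yl; rewrite mem_cat yl.
- move=> s; rewrite !mem_cat => /orP[sl|/mapP[t tl ->]].
    by rewrite map_f ?orbT.
  by rewrite invgK tl.
Qed.

(** * Powers and roots in nilpotent groups *)

Section Isolation.
Variables (G : groupType) (M : set G) (hM : is_normal M).

Lemma prX (A : set G) (hA : is_normal A) x n : pr hA (x ^+ n) = pr hA x ^+ n.
Proof. exact: gmulfXn. Qed.

(** When [[~ u, x]] is central, the commutator with [x] is multiplicative in
    powers of [u]. *)
Lemma commX_mod (A : set G) (hA : is_normal A) u x n : central_mod A [~ u, x] ->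
  A [~ u ^+ n, x] <-> A ([~ u, x] ^+ n).
Proof.
move=> /(central_modP hA) cux; rewrite -!(prE1 hA) prX.
suff -> : pr hA [~ u ^+ n, x] = pr hA [~ u, x] ^+ n by [].
elim: n => [|n IH]; first by rewrite !expg0 comm1g; exact: proj1g.
have -> : [~ u ^+ n.+1, x] = [~ u, x] ^ (u ^+ n) * [~ u ^+ n, x].
  by rewrite expgS /commg /conjg !gnorm.
rewrite prM IH expgS; congr (_ * _); move: [~ u, x] cux => t ct.
by rewrite /conjg !(prM, prV) (ct (u ^+ n)) mulKg.
Qed.

Lemma upper_centralS1 i : upper_central M i `<=` upper_central M i.+1.
Proof. exact: (sub_central_mod (upper_central_normal i hM)). Qed.

(** Commutators carry the exponent of the centre up to every factor of the upper
    central series. *)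
Lemma upper_central_exponent E i u :
  (forall u, central_mod M u -> M (u ^+ E)) ->
  upper_central M i.+1 u -> upper_central M i (u ^+ E).
Proof.
move=> EM; elim: i u => [|i IH] u; first exact: EM.
move=> Uu x; have cux : central_mod (upper_central M i) [~ u, x] by exact: Uu.
by apply/(commX_mod (upper_central_normal i hM) _ cux)/IH/cux.
Qed.

Lemma nilpotent_exponent E : nilpotent_mod M ->
  (forall u, central_mod M u -> M (u ^+ E)) -> forall g, exists n, M (g ^+ (E ^ n)).
Proof.
move=> [c Uc] EM g; exists c.
have : upper_central M c g by rewrite Uc.
elim: c g {Uc} => [|c IH] g Ug; first by rewrite expn0 expg1.
by rewrite expnS expgnA; apply: IH; exact: upper_central_exponent.
Qed.

Hypothesis isolated : forall u n, (0 < n)%N -> central_mod M u -> M (u ^+ n) -> M u.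

(** Torsion-freeness of the centre propagates to every factor of the upper
    central series, through commutators. *)
Lemma upper_central_isolated i u n : (0 < n)%N ->
  upper_central M i.+1 u -> upper_central M i (u ^+ n) -> upper_central M i u.
Proof.
move=> n0; elim: i u => [|i IH] u; first exact: isolated.
move=> Uu Uun x; have cux : central_mod (upper_central M i) [~ u, x] by exact: Uu.
apply: IH => //; apply/(commX_mod (upper_central_normal i hM) _ cux); exact: Uun.
Qed.

(** Descending the upper central series: when [g^-1 * h] is central modulo one
    term, its [n]th power equals [g ^- n * h ^+ n] modulo this term, and
    [upper_central_isolated] brings [g^-1 * h] itself one term lower. *)
Lemma unique_roots_mod g h n : nilpotent_mod M -> (0 < n)%N ->
  central_mod M ((g ^+ n)^-1 * h ^+ n) -> central_mod M (g^-1 * h).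
Proof.
move=> [c Uc] n0 Mgh; set u := g^-1 * h.
have sub i : central_mod M `<=` upper_central M i.+1.
  by elim: i => [//|i IH] x /IH; exact: upper_centralS1.
have desc i : upper_central M i.+1 u -> central_mod M u.
  elim: i => [//|i IH] Uu; apply: IH; apply: (upper_central_isolated n0 Uu).
  have hA := upper_central_normal i.+1 hM.
  have /(central_modP hA) cu := Uu.
  have /(prE1 hA) := sub i _ Mgh; rewrite prM prV !prX => ghE.
  apply/(prE1 hA); rewrite prX -ghE -[h](mulVKg g) -/u prM expgMn ?mulKg //.
  exact/commute_sym/cu.
by apply: (desc c); apply: upper_centralS1; rewrite Uc.
Qed.

End Isolation.

(** * Extending an order from the centre *)

Section FactorizingFacts.
Variables (G : groupType) (lt : relation G).
Hypothesis nfa : nontrivial_full_archimedean lt.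

Let ltO : is_order lt. Proof. by case: nfa. Qed.

Lemma antichain_sub_isotropy A : is_normal A -> antichain lt A -> A `<=` isotropy lt.
Proof.
move=> hA aA; have [_ _ [_ /(factorizingP ltO) fac] _] := nfa.
by apply: fac => //; apply/(antichainP ltO hA.1).
Qed.

(** As the quotient by [A] is abelian, every element is central modulo the
    isotropy, hence lies in the half-space up to inversion. *)
Lemma half_space_generates A : is_normal A -> antichain lt A ->
  (forall x y, A [~ x, y]) -> coarsely_connected (half_space lt) ->
  finitely_generated [set: G].
Proof.
move=> hA aA abA /coarsely_connected_elim[l [sub _]].
have AI := antichain_sub_isotropy hA aA.
have [_ _ [prim fac] _] := nfa; have [g1 gM gV] := generated_subgroup [set` l].
apply/fgP; exists l; apply/seteqP; split=> // x _.
have cx : central_mod (isotropy lt) x by move=> y; exact: AI.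
case: (central_comparable ltO prim fac cx) => h.
- by apply: sub; left.
- by apply: sub; right.
- by rewrite -(invgK x); apply: gV; apply: sub; right.
Qed.

Lemma half_space_coarsely_connected_abelian A : is_normal A -> antichain lt A ->
  (forall x y, A [~ x, y]) -> finitely_generated [set: G] ->
  finitely_generated (isotropy lt) -> coarsely_connected (half_space lt).
Proof.
move=> hA aA abA /fgP[l lE] fI; have AI := antichain_sub_isotropy hA aA.
have [_ _ [prim fac] _] := nfa.
apply: half_space_coarsely_connected => //; last by move=> g _ x; exact: AI.
have -> : central_mod (isotropy lt) = [set: G].
  by apply/seteqP; split=> // g _ x; exact: AI.
exists l; apply/seteqP; split=> // x _; move: (I : setT x); rewrite -lE.
by apply: generatedS; right.
Qed.

Lemma Sigma1_half_space : Sigma1_ord lt -> coarsely_connected (half_space lt).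
Proof.
have [_ _ [_ fac] _] := nfa.
move=> [_ /(_ (mk_normal (isotropy_normal ltO)))]; rewrite -upper_setE //; apply.
exact/maximal_isotropy.
Qed.

End FactorizingFacts.

Section Extension.
Variables (G : groupType) (M : set G) (hM : is_normal M) (nil : nilpotent_mod M).
Let Z := central_mod M.
Let hZ : is_normal Z := central_mod_normal hM.
Let H : subgroup G := mk_subgroup hZ.1.
Notation T := (subgroup_type H).
Let inc : T -> G := @inclusion G H.
Variable lt0 : relation T.
Hypothesis nfa0 : nontrivial_full_archimedean lt0.
Hypothesis iso0 : forall x : T, isotropy lt0 x <-> M (inc x).

Let ltO0 : is_order lt0. Proof. by case: nfa0. Qed.

Definition extended_cone : set G := inc @` [set x | lt0 1 x].
Let P := extended_cone.

Lemma extended_coneE x : P (inc x) <-> lt0 1 x.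
Proof. by split=> [[y /= Py /inclusion_inj <-]|Px] //; exists x. Qed.

Lemma incM x y : inc (x * y) = inc x * inc y. Proof. exact: gmulfM. Qed.
Lemma incV x : inc x^-1 = (inc x)^-1. Proof. exact: gmulfV. Qed.
Lemma incX x n : inc (x ^+ n) = inc x ^+ n. Proof. exact: gmulfXn. Qed.

Lemma incZ x i : inc (zpow x i) = zpow (inc x) i.
Proof. exact: (zpow_proj (@inclusion G H : UMagmaMorphism.type _ _)). Qed.

Lemma lift_central u : Z u -> exists x, inc x = u.
Proof. exact: (@inclusion_lift _ H u). Qed.

Lemma extended_comparable u : Z u -> [\/ M u, P u | P u^-1].
Proof.
move=> /lift_central[x <-]; have [_ _ [prim fac] _] := nfa0.
have cx : central_mod (isotropy lt0) x.
  move=> y; apply/iso0; rewrite /inc gmulfR; exact: (inclusionP x).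
case: (central_comparable ltO0 prim fac cx) => h.
- by constructor 1; apply/iso0.
- by constructor 2; apply/extended_coneE.
- by constructor 3; rewrite -incV; apply/extended_coneE.
Qed.

Lemma extended_cone_mod u m : M m -> P u -> P (u * m).
Proof.
move=> Mm [x Px <-]; have [y yE] := lift_central (sub_central_mod hM Mm).
rewrite -yE -incM; apply/extended_coneE; apply/(_ : isotropy lt0 y) => //.
by apply/iso0; rewrite yE.
Qed.

Lemma extended_cone_not_mod u : M u -> ~ P u.
Proof.
by move=> Mu [x Px xu]; apply: (isotropy_not_cone ltO0 _ Px); apply/iso0; rewrite xu.
Qed.

Lemma extended_coneM u v : P u -> P v -> P (u * v).
Proof.
by move=> [x Px <-] [y Py <-]; rewrite -incM; apply/extended_coneE; exact: coneM.
Qed.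

Lemma extended_coneX u n : P u -> P (u ^+ n.+1).
Proof.
by move=> [x Px <-]; rewrite -incX; apply/extended_coneE; exact: coneX.
Qed.

Lemma extended_cone_root u n : Z u -> P (u ^+ n) -> P u.
Proof.
move=> /lift_central[x <-]; rewrite -incX => /extended_coneE Px.
have [_ _ [prim _] _] := nfa0; apply/extended_coneE.
exact: (primitive_cone ltO0 prim Px).
Qed.

Lemma extended_isolated u n : (0 < n)%N -> Z u -> M (u ^+ n) -> M u.
Proof.
case: n => // n _ Zu Mun; case: (extended_comparable Zu) => // Pu.
  by case: (extended_cone_not_mod Mun); exact: extended_coneX.
case: hM => -[_ _ MV] _; have := MV _ Mun; rewrite -expVgn => Mun'.
by case: (extended_cone_not_mod Mun'); exact: extended_coneX.
Qed.

(** A normal subgroup not contained in [M] contains an element outside [M] that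
    is central modulo [M], hence positive up to inversion. *)
Lemma extended_cone_free_sub A : is_normal A -> (forall x, A x -> ~ P x) -> A `<=` M.
Proof.
move=> hA nA x Ax; apply: contrapT => nMx; have [[_ AM AV] AJ] := hA.
have [|u [Au nMu Zu]] := central_mod_meet nil _ Ax nMx.
  by move=> y z Ay; apply: AM; [exact: AV|exact: AJ].
case: (extended_comparable Zu) => // Pu; first exact: nA Au Pu.
by apply: nA Pu; exact: AV.
Qed.

Definition extended_order : relation G := fun g h => P (g^-1 * h).

(** The cone is invariant under conjugation because it consists of elements
    central modulo [M] and is a union of cosets of [M]. Primitivity reduces to
    the relative centre by [unique_roots_mod]. *)
Lemma extended_order_nfa : nontrivial_full_archimedean extended_order.
Proof.
have [_ ntriv [prim fac] arch] := nfa0.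
apply: cone_order_nfa.
- by apply: extended_cone_not_mod; case: hM => -[].
- exact: extended_coneM.
- move=> u g Pu; rewrite -(mulVKg u (u ^ g)); apply: extended_cone_mod => //.
  by case: Pu => x _ <-; exact: (inclusionP x).
- apply: contrapT => nP; apply: ntriv => x y /(lt_cone ltO0) xy.
  by apply: nP; exists (inc (x^-1 * y)); apply/extended_coneE.
- move=> g h n n0 Pgh; set u := g^-1 * h.
  have Zgh : Z ((g ^+ n)^-1 * h ^+ n) by case: Pgh => x _ <-; exact: (inclusionP x).
  have Zu : Z u := unique_roots_mod hM extended_isolated nil n0 Zgh.
  apply: (extended_cone_root (n := n) Zu).
  rewrite -(mulVKg ((g ^+ n)^-1 * h ^+ n) (u ^+ n)); apply: extended_cone_mod => //.
  apply/(prP hM); move/(central_modP hM): Zu => cu.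
  rewrite prM prV !prX -[h](mulVKg g) -/u prM expgMn ?mulKg //.
  exact/commute_sym/cu.
- by move=> A hA nA g h Pg /(extended_cone_free_sub hA nA) Mh; exact: extended_cone_mod.
- move=> g h [x Px <-]; apply: contrapT => /forallNP all.
  have Pi i : P ((zpow (inc x) i)^-1 * h) by exact: contrapT (all i).
  have := Pi (Posz 0); rewrite /= expg0 invg1 mul1g => -[y _ yh].
  apply: arch; exists x, y; split=> // i; apply/(lt_cone ltO0)/extended_coneE.
  by rewrite incM incV incZ yh; exact: Pi.
Qed.

Lemma extended_order1 g : extended_order 1 g <-> P g.
Proof. by rewrite /extended_order invg1 mul1g. Qed.

Lemma extended_antichain : antichain extended_order M.
Proof.
have [eO _ _ _] := extended_order_nfa; apply/(antichainP eO hM.1) => x Mx /extended_order1.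
exact: extended_cone_not_mod.
Qed.

Lemma extended_isotropy : isotropy extended_order = M.
Proof.
have [eO _ _ _] := extended_order_nfa; apply/seteqP; split.
  apply: extended_cone_free_sub; first exact: isotropy_normal.
  by move=> x /(isotropy_not_cone eO) nx /extended_order1.
exact: (antichain_sub_isotropy extended_order_nfa hM extended_antichain).
Qed.

Lemma half_space_of_extended : coarsely_connected (half_space extended_order) ->
  coarsely_connected (half_space lt0).
Proof.
have -> : half_space lt0 = inc @^-1` half_space extended_order.
  apply/seteqP; split=> x /= [Ix|Px].
  - by left; rewrite extended_isotropy; apply/iso0.
  - by right; apply/extended_order1/extended_coneE.
  - by left; apply/iso0; rewrite -extended_isotropy.
  - by right; apply/extended_coneE/extended_order1.
apply: coarsely_connected_preimage.
  move=> g [|/extended_order1[x _ <-]]; last exact: (inclusionP x).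
  by rewrite extended_isotropy; exact: (sub_central_mod hM).
by left; rewrite extended_isotropy; case: hM => -[].
Qed.

End Extension.

(** In a maximal counterexample [M], only the orders on the relative centre with
    isotropy exactly [M] escape the first implication, and these extend to the
    whole group with an unchanged half-space. *)
Lemma finitely_generated_of_Sigma1 (G : groupType) (N : normalSubgroup G) :
  finitely_generated [set: G] -> nilpotent_mod N -> S_ord N `<=` @Sigma1_ord G ->
  finitely_generated N.
Proof.
move=> fG [c Uc] orders; apply: contrapT => nN.
have [M [hM NM nM maxM]] := maximal_not_fg (normalP N) nN.
have nil : nilpotent_mod M.
  by exists c; apply/seteqP; split=> // x _; apply: (upper_centralS NM); rewrite Uc.
pose hZ := central_mod_normal hM.
have [x nMx] : exists x, ~ M x.
  apply: contrapT => /forallNP aM; apply: nM; suff -> : M = setT by [].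
  by apply/seteqP; split=> // x _; apply: contrapT; exact: aM.
have [u [_ nMu Zu]] := @central_mod_meet _ M setT x nil (fun _ _ _ => Logic.I) Logic.I nMx.
have fZ : finitely_generated (central_mod M).
  by apply: maxM => //; [exact: sub_central_mod|move=> /(_ u Zu)].
pose H := mk_subgroup hZ.1; pose T := subgroup_type H.
pose inc : T -> G := @inclusion G H; pose N0 := inc @^-1` M.
have [[M1 MM MV] MJ] := hM.
have hN0 : is_normal N0.
  split; first split=> [|y z|y] /=; rewrite /N0 /= /inc ?gmulf1 ?gmulfM ?gmulfV; auto.
  by move=> y z; rewrite /N0 /= /inc gmulfJ; exact: MJ.
have ab0 (y z : T) : N0 [~ y, z].
  by rewrite /N0 /= /inc gmulfR; exact: (inclusionP y).
have fT : finitely_generated [set: T].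
  have -> : [set: T] = inc @^-1` central_mod M.
    by apply/seteqP; split=> // y _; exact: (inclusionP y).
  exact: finitely_generated_preimage.
have MN0 : inc @` N0 = M.
  apply/seteqP; split=> [_ [y Ny <-]//|m Mm].
  have [y yE] := @inclusion_lift _ H m (sub_central_mod hM Mm).
  by exists y => //; rewrite /N0 /= /inc yE.
apply: nM; rewrite -MN0; apply: finitely_generated_image.
apply: finitely_generated_of_orders => // lt0 nfa0 aN0.
have [ltO0 _ _ _] := nfa0; have [_ I0J] := isotropy_normal ltO0.
have N0I := antichain_sub_isotropy nfa0 hN0 aN0.
(* An isotropy larger than [M] is normal in [G], because the commutators of
   the relative centre lie in [M]; so it is finitely generated by maximality. *)
have [IN0|nIN0] := pselect (isotropy lt0 `<=` N0); last first.
  apply: (half_space_coarsely_connected_abelian nfa0 hN0) => //.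
  have [[I1 IM IV] _] := isotropy_normal ltO0.
  pose I := inc @` isotropy lt0.
  have hI : is_normal I.
    split; first split.
    - by exists 1 => //; exact: gmulf1.
    - by move=> _ _ [y Iy <-] [z Iz <-]; exists (y * z); [exact: IM|exact: gmulfM].
    - by move=> _ [y Iy <-]; exists y^-1; [exact: IV|exact: gmulfV].
    move=> _ g [y Iy <-]; have Myg : M [~ inc y, g] := inclusionP y g.
    have [m mE] := @inclusion_lift _ H _ (sub_central_mod hM Myg).
    exists (y * m); last by rewrite /inc gmulfM /= mE mulVKg.
    by apply: IM => //; apply: N0I; rewrite /N0 /= /inc mE.
  have fI : finitely_generated I.
    apply: maxM => //; first by rewrite -MN0; exact: image_subset.
    by move=> IM'; apply: nIN0 => y Iy; apply: IM'; exists y.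
  have -> : isotropy lt0 = inc @^-1` I.
    by apply/seteqP; split=> y; [exists y|move=> [z Iz /inclusion_inj <-]].
  apply: finitely_generated_preimage => //.
  by move=> _ [y _ <-]; exact: (inclusionP y).
have iso0 (y : T) : isotropy lt0 y <-> M (inc y) by split=> [/IN0|/N0I].
apply: (half_space_of_extended nil nfa0 iso0).
have enfa := extended_order_nfa nil nfa0 iso0.
apply: (Sigma1_half_space enfa); apply: orders; apply/S_ordP; split=> //.
have aM := extended_antichain nil nfa0 iso0.
by move=> s t Ns Nt; apply: aM; exact: NM.
Qed.

(** * Groups without orders, and the centre of the quotient *)

Lemma coordinate_order_nfa (G : groupType) (phi : G -> int) :
  (forall x y, phi (x * y) = (phi x + phi y)%R) -> (exists g, (0 < phi g)%R) ->
  nontrivial_full_archimedean (fun g h : G => (0 < phi (g^-1 * h)%g)%R).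
Proof.
move=> phiM [p p0].
have phi1 : phi 1 = 0%R by apply: (addrI (phi 1)); rewrite -phiM mulg1 addr0.
have phiV x : phi x^-1 = (- phi x)%R.
  by apply: (addrI (phi x)); rewrite -phiM mulgV phi1 subrr.
have phiX x n : phi (x ^+ n) = (phi x *+ n)%R.
  by elim: n => [|n IH]; rewrite ?expg0 // expgS phiM IH mulrS.
apply: (@cone_order_nfa G [set g | (0 < phi g)%R]) => /=.
- by rewrite phi1 ltxx.
- by move=> x y x0 y0; rewrite phiM addr_gt0.
- by move=> x g; rewrite /conjg !phiM phiV addrC addrK.
- by exists p.
- by move=> g h n n0; rewrite !phiM !phiV !phiX -mulNrn -mulrnDl pmulrn_lgt0.
- move=> A [[_ _ AV] _] nA g h g0 Ah; rewrite phiM.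
  have := nA _ Ah; have := nA _ (AV _ Ah); rewrite phiV; lia.
- move=> g h g0; exists (Posz (absz (phi h))) => /=.
  rewrite phiM phiV phiX -mulr_natr natz; nia.
Qed.

(** A coordinate that does not vanish identically would define an order. *)
Lemma torsion_of_no_order (G : groupType) (N : set G) : is_normal N ->
  (forall x y, N [~ x, y]) -> fg_mod N [set: G] ->
  (forall lt : relation G, nontrivial_full_archimedean lt -> ~ antichain lt N) ->
  forall x, exists2 e, (0 < e)%N & N (x ^+ e).
Proof.
move=> hN abN fN no x.
have [n [lam [lamM lam0 lamT lam_delta]]] := coordinates hN abN fN.
apply: lamT; apply/rowP => i; rewrite mxE.
case: (lam_delta i) => [[g [c [c0 gE]]]|->//].
have phiM a b : (lam (a * b)%g 0 i = lam a 0 i + lam b 0 i)%R by rewrite lamM mxE.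
have nfa : nontrivial_full_archimedean (fun g h : G => (0 < lam (g^-1 * h)%g 0 i)%R).
  apply: (coordinate_order_nfa (phi := fun g => lam g 0%R i)) => //.
  by exists g; rewrite gE !mxE !eqxx mulr1.
case: (no _ nfa); have [ltO _ _ _] := nfa.
by apply/(antichainP ltO hN.1) => a Na; rewrite invg1 mul1g lam0 // mxE ltxx.
Qed.

Section KernelAndCenter.
Variables (G Q : groupType) (Phi : UMagmaMorphism.type G Q).
Hypotheses (G_fg : finitely_generated [set: G]) (Q_nil : nilpotent_group Q).
Hypothesis (Phi_surj : forall q : Q, exists g : G, Phi g = q).
Let N := kernel Phi.
Let Zbar : subgroup G := preimage_subgroup Phi (center_subgroup Q).
Notation T := (subgroup_type Zbar).
Let N0 := restrict_normal Zbar N.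

(** Pull-back of the lower central series of [Q], read upwards. *)
Lemma kernel_nilpotent_mod : nilpotent_mod N.
Proof.
have [n Qn] := Q_nil; exists n; apply/seteqP; split=> // x _.
suff H i : (i <= n)%N -> forall x, lower_central (n - i) (Phi x) -> upper_central N i x.
  by apply: (H n) => //; rewrite subnn.
elim: i => [_|i IH ltin] {}x; first by rewrite subn0 Qn.
move=> Lx y; apply: IH; first exact: ltnW.
by rewrite gmulfR -(subnSK ltin); exact: lower_central_comm.
Qed.

Lemma kernel_noetherian : noetherian_mod N [set: G].
Proof. exact: (noetherian_nilpotent G_fg (normalP N) kernel_nilpotent_mod). Qed.

Lemma Zbar_central_mod : (Zbar : set G) = central_mod N.
Proof.
apply/seteqP; split=> x /= cx y.
  by rewrite /= gmulfR; apply/eqP/commgP/cx.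
have [g <-] := Phi_surj y; apply/commgP; rewrite -gmulfR; apply/eqP; exact: cx.
Qed.

Lemma restrict_abelian (x y : T) : (N0 : set T) [~ x, y].
Proof.
have : central_mod N (inclusion x) by rewrite -Zbar_central_mod; exact: (inclusionP x).
by move=> /(_ (inclusion y)); rewrite /= !gmulfR.
Qed.

Lemma sub_Zbar : (N : set G) `<=` (Zbar : set G).
Proof. by rewrite Zbar_central_mod; exact: sub_central_mod (normalP N). Qed.

Lemma image_restrict : (@inclusion G Zbar) @` (N0 : set T) = N.
Proof.
apply/seteqP; split=> [_ [y Ny <-]//|m Nm].
have [y yE] := inclusion_lift (sub_Zbar Nm).
by exists y => //; rewrite /= yE.
Qed.

Lemma Zbar_fg_mod : fg_mod N Zbar.
Proof. by apply: kernel_noetherian => //; [exact: subgroupP|exact: sub_Zbar]. Qed.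

Lemma restrict_fg_mod : fg_mod N0 [set: T].
Proof.
have [l lE] := Zbar_fg_mod.
have [|l' l'E] := @inclusion_lift_seq _ Zbar l.
  by move=> x xl; rewrite -lE; exact: mem_span.
exists l'; apply/seteqP; split=> // x _.
have : ((@inclusion G Zbar) @` span N0 l') (inclusion x).
  rewrite image_generated image_setU image_restrict.
  have -> : (@inclusion G Zbar) @` [set` l'] = [set` l].
    apply/seteqP; split=> y; first by move=> [z zl <-]; rewrite /= -l'E; exact: map_f.
    by rewrite /= -l'E => /mapP[z zl ->]; exists z.
  by rewrite -/(span N l) lE; exact: (inclusionP x).
by move=> [y gy /inclusion_inj <-].
Qed.

Lemma Sigma1_center_of_fg : finitely_generated N -> S_ord N0 `<=` @Sigma1_ord T.
Proof.
move=> fN; apply: Sigma1_of_finitely_generated.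
- by exists 1%N; apply/seteqP; split=> // x _ y; exact: restrict_abelian.
- apply: (@noetherian_nilpotent _ N0); [|exact: normalP|].
    have -> : [set: T] = (@inclusion G Zbar) @^-1` Zbar.
      by apply/seteqP; split=> // x _; exact: (inclusionP x).
    apply: finitely_generated_preimage => //.
    exact: fg_mod_fg Zbar_fg_mod fN.
  by exists 1%N; apply/seteqP; split=> // x _ y; exact: restrict_abelian.
- exact: finitely_generated_preimage sub_Zbar fN.
Qed.

(** The centre of [Q] is finitely generated, abelian and torsion, so it has a
    finite exponent, and a power of this exponent annihilates [Q]. *)
Lemma torsion_kernel : (forall x : T, exists2 e, (0 < e)%N & (N0 : set T) (x ^+ e)) ->
  forall g, exists2 e, (0 < e)%N & (N : set G) (g ^+ e).
Proof.
move=> tor.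
have [E E0 EP] : exists2 E, (0 < E)%N & forall x : T, (N0 : set T) (x ^+ E).
  have [l lE] := restrict_fg_mod; have hN0 := normalP N0.
  have [[N1 NM NV] NJ] := hN0.
  have [E E0 El] : exists2 E, (0 < E)%N & {in l, forall x : T, (N0 : set T) (x ^+ E)}.
    elim: (l) => [|x l' [E E0 El]]; first by exists 1%N.
    have [e e0 xe] := tor x; exists (e * E)%N; first by rewrite muln_gt0 e0.
    move=> y; rewrite in_cons => /orP[/eqP->|/El yE].
      by rewrite expgnA; exact: (is_subgroupX _ hN0.1).
    by rewrite mulnC expgnA; exact: (is_subgroupX _ hN0.1).
  exists E => // x; have : span N0 l x by rewrite lE.
  apply: (@span_min _ _ _ [set x : T | (N0 : set T) (x ^+ E)]) => //; last first.
    by move=> y Ny; exact: (is_subgroupX _ hN0.1).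
  have prc (a b : T) : commute (pr hN0 a) (pr hN0 b).
    by have /(central_modP hN0) : central_mod N0 a by move=> ?; exact: restrict_abelian.
  split=> [|a b aE bE|a aE] /=; first by rewrite expg1n.
    apply/(prE1 hN0); rewrite prX prM expgMn // -!prX.
    by rewrite ((prE1 hN0 _).2 aE) ((prE1 hN0 _).2 bE) mulg1.
  by rewrite expVgn; exact: NV.
have EM u : central_mod N u -> (N : set G) (u ^+ E).
  rewrite -Zbar_central_mod => /inclusion_lift[x <-].
  by have := EP x; rewrite /= gmulfXn.
move=> g; have [n Nn] := nilpotent_exponent (normalP N) kernel_nilpotent_mod EM g.
by exists (E ^ n)%N => //; rewrite expn_gt0 E0.
Qed.

(** The powers of a positive element are positive, so an order for which [N] is
    an antichain is trivial when [G / N] is torsion. *)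
Lemma finitely_generated_of_Sigma1_center :
  S_ord N0 `<=` @Sigma1_ord T -> finitely_generated N.
Proof.
move=> orders.
have [[lt [nfa aN]]|no] := pselect (exists lt : relation T,
    nontrivial_full_archimedean lt /\ antichain lt N0).
  have cc (lt' : relation T) : nontrivial_full_archimedean lt' -> antichain lt' N0 ->
      coarsely_connected (half_space lt').
    by move=> nfa' aN'; apply: Sigma1_half_space => //; apply: orders; apply/S_ordP.
  rewrite -image_restrict; apply: finitely_generated_image.
  apply: finitely_generated_of_orders => //; [exact: normalP|exact: restrict_abelian|].
  by apply: (half_space_generates nfa (normalP N0) aN restrict_abelian); exact: cc.
have tor : forall x : T, exists2 e, (0 < e)%N & (N0 : set T) (x ^+ e).
  apply: torsion_of_no_order; [exact: normalP|exact: restrict_abelian|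
    exact: restrict_fg_mod|].
  by move=> lt nfa aN; apply: no; exists lt.
apply: (finitely_generated_of_Sigma1 G_fg kernel_nilpotent_mod) => lt /S_ordP[nfa aN].
have [ltO ntriv _ _] := nfa; case: ntriv => g h /(lt_cone ltO) gh.
have [[//|e] _ Ne] := torsion_kernel tor (g^-1 * h).
by move/(antichainP ltO (subgroupP N)) : aN => /(_ _ Ne); apply; exact: coneX.
Qed.

End KernelAndCenter.

Theorem theorem5p3 (G Q : groupType) (Phi : UMagmaMorphism.type G Q)
    (G_fg : finitely_generated [set: G])
    (Q_fg : finitely_generated [set: Q])
    (Q_nil : nilpotent_group Q)
    (Phi_surj : forall q : Q, exists g : G, Phi g = q) :
  let Zbar : subgroup G := preimage_subgroup Phi (center_subgroup Q) in
  [<-> finitely_generated (kernel Phi);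
       S_ord (kernel Phi) `<=` @Sigma1_ord G;
       S_ord (restrict_normal Zbar (kernel Phi))
         `<=` @Sigma1_ord (subgroup_type Zbar)].
Proof.
move=> Zbar; have nil := kernel_nilpotent_mod Phi Q_nil.
tfae.
- exact: (Sigma1_of_finitely_generated nil (kernel_noetherian G_fg Q_nil)).
- by move=> /(finitely_generated_of_Sigma1 G_fg nil); exact: Sigma1_center_of_fg.
- exact: finitely_generated_of_Sigma1_center.
Qed.
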